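(* Let $k\ge 2$, let $R=\mathbb{C}[x,y]/(x^k)$ be $\mathbb{Z}$-graded with $\deg x=1$, $\deg y=-1$, and let $\mathcal{C}=\mathrm{MCM}_{\mathbb{Z}}R$. Let $I$ and $J$ be generically free modules of rank $1$ in $\mathcal{C}$, with corresponding Plücker coordinates $p_{\underline{\ell}(I)}$ and $p_{\underline{\ell}(J)}$. Then $\mathrm{Ext}^1_{\mathcal{C}}(I,J)=0$ if and only if $p_{\underline{\ell}(I)}$ and $p_{\underline{\ell}(J)}$ are compatible, i.e. if and only if the $k$-subsets $\underline{\ell}(I)$ and $\underline{\ell}(J)$ of $\mathbb{Z}$ are noncrossing.
   Context: Gradings: for a graded module $M$, $M(j)$ is the shift $M(j)_i=M_{i+j}$; morphisms of graded modules are homogeneous of degree $0$. $\mathrm{gr}R$ is the category of finitely generated $\mathbb{Z}$-graded $R$-modules. $\mathrm{MCM}_{\mathbb{Z}}R$ is the full subcategory of $\mathrm{gr}R$ of maximal Cohen--Macaulay modules, i.e. those $M$ with $\mathrm{Ext}^i_R(M,R)=0$ for all $i>0$ (equivalently, since $R$ is Gorenstein, $\mathrm{depth}(M_{\mathfrak p})=\dim R_{\mathfrak p}$ for all primes $\mathfrak p$ in the support of $M$). $\mathrm{Ext}^1_{\mathcal{C}}(I,J)$ is the space of extensions of $I$ by $J$ in the exact category $\mathcal{C}$, i.e. $\mathrm{Ext}^1$ in $\mathrm{gr}R$ (the degree $0$ part of $\mathrm{Ext}^1_R(I,J)$). Let $\mathcal{F}=R_y=\mathbb{C}[x,y^{\pm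 1}]/(x^k)$. $M\in\mathrm{gr}R$ is generically free of rank $n$ if $M\otimes_R\mathcal{F}$ is a graded free $\mathcal{F}$-module of rank $n$. Every generically free module of rank $1$ in $\mathrm{MCM}_{\mathbb{Z}}R$ is isomorphic to exactly one module $I=(x^{k-1},x^{k-2}y^{i_1},\dots,xy^{i_{k-2}},y^{i_{k-1}})(i_k)$ with $0\le i_1\le\dots\le i_{k-1}$, $i_k\in\mathbb{Z}$, and one associates to it the $k$-subset $$\underline{\ell}(I)=\{-i_k-i_{k-1},\,-i_k-i_{k-2}+1,\,\dots,\,-i_k-i_1+k-2,\,-i_k+k-1\}\subseteq\mathbb{Z}$$ and the Plücker coordinate $p_{\underline{\ell}(I)}$ (a generator, indexed by a $k$-element subset of $\mathbb{Z}$, of the ring $\mathcal{A}_k=\mathbb{C}[p_{\underline{\ell}}\mid\underline{\ell}\subseteq\mathbb{Z},|\underline{\ell}|=k]/\langle\text{Plücker relations}\rangle$). Two $k$-subsets $A,B\subseteq\mathbb{Z}$ cross if there exist $a_1,a_2\in A\setminus B$ and $b_1,b_2\in B\setminus A$ with $a_1<b_1<a_2<b_2$ or $b_1<a_1<b_2<a_2$; they are noncrossing if they do not cross. Two Plücker coordinates $p_A,p_B$ are compatible if $A$ and $B$ are noncrossing. *)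

(* Defs.v *)
From HB Require Import structures.
From mathcomp Require Import all_boot all_order all_algebra.
From mathcomp Require Import finmap.
From mathcomp Require Import zify.
From mathcomp Require Import boolp reals complex.

Set Implicit Arguments.
Unset Strict Implicit.
Unset Printing Implicit Defensive.

Import Order.TTheory GRing.Theory Num.Theory.
Local Open Scope ring_scope.

Section Ext.
Variable A : comNzRingType.

Definition projective (P : lmodType A) : Prop :=
  forall (U V : lmodType A) (g : {linear U -> V}) (f : {linear P -> V}),
    (forall v, exists u, g u = v) ->
    exists h : {linear P -> U}, forall p, g (h p) = f p.

Record proj_resolution (M : lmodType A) := ProjResolution {
  pr_mod : nat -> lmodType A;
  pr_d : forall n, {linear pr_mod n.+1 -> pr_mod n};
  pr_aug : {linear pr_mod 0%N -> M};
  pr_proj : forall n, projective (pr_mod n);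
  pr_aug_surj : forall m, exists p, pr_aug p = m;
  pr_exact0 : forall p, pr_aug p = 0 <-> exists q, p = pr_d 0%N q;
  pr_exact : forall n p, pr_d n p = 0 <-> exists q, p = pr_d n.+1 q
}.

Definition cocycle (M N : lmodType A) (P : proj_resolution M) n
    (f : {linear pr_mod P n -> N}) : Prop :=
  forall q, f (pr_d P n q) = 0.

Definition coboundary (M N : lmodType A) (P : proj_resolution M) n :
    {linear pr_mod P n -> N} -> Prop :=
  match n with
  | 0%N => fun f => forall p, f p = 0
  | n'.+1 => fun f =>
      exists g : {linear pr_mod P n' -> N}, forall p, f p = g (pr_d P n' p)
  end.

(* The cohomology of Hom(P, N) does not depend on the projective resolution P
   of M, and every module has one, so "for all P" and "for some P" agree. *)
Definition Ext_eq0 (n : nat) (M N : lmodType A) : Prop :=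
  forall (P : proj_resolution M) (f : {linear pr_mod P n -> N}),
    cocycle f -> coboundary f.

Definition finitely_generated (M : lmodType A) : Prop :=
  exists n (g : 'I_n -> M), forall m, exists c : 'I_n -> A,
    m = \sum_i c i *: g i.

End Ext.

Section Ideals.
Variables (A : comNzRingType) (n : nat) (g : 'I_n -> A).

Definition ideal_pred : pred A^o :=
  fun r => `[< exists c : 'I_n -> A, r = \sum_i c i * g i >].

Fact ideal_submod_closed : submod_closed ideal_pred.
Proof.
split=> [|a u v /asboolP[c ->] /asboolP[d ->]]; apply/asboolP.
  by exists (fun=> 0); rewrite big1 // => i _; rewrite mul0r.
exists (fun i => a * c i + d i).
rewrite -mulr_algl /= [a%:A]mulr1 mulr_sumr -big_split /=.
by apply: eq_bigr => i _; rewrite mulrDl mulrA.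
Qed.

HB.instance Definition _ :=
  GRing.isSubmodClosed.Build A A^o ideal_pred ideal_submod_closed.

Record ideal : predArgType := Ideal {
  ideal_val : A^o;
  _ : ideal_val \in ideal_pred }.

HB.instance Definition _ := [isSub for ideal_val].
HB.instance Definition _ := [Choice of ideal by <:].
HB.instance Definition _ := [SubChoice_isSubLmodule of ideal by <:].

Fact ideal_val_sum (T : Type) (s : seq T) (u : T -> ideal) :
  ideal_val (\sum_(t <- s) u t) = \sum_(t <- s) ideal_val (u t).
Proof. exact: (raddf_sum val). Qed.

End Ideals.

Section Laurent.
Variable K : fieldType.

Definition laurent_pred : pred {fraction {poly K}} :=
  fun f => `[< exists n (p : {poly K}),
    f * FracField.tofrac 'X ^+ n = FracField.tofrac p >].

Fact laurent_subring_closed : subring_closed laurent_pred.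
Proof.
split=> [|u v /asboolP[n [p up]] /asboolP[m [q vq]]
        |u v /asboolP[n [p up]] /asboolP[m [q vq]]]; apply/asboolP.
- by exists 0%N, 1; rewrite mul1r expr0 tofrac1.
- exists (n + m)%N, (p * 'X^m - q * 'X^n).
  rewrite tofracB !tofracM -up -vq !tofracXn mulrBl exprD mulrA.
  by congr (_ - _); rewrite -mulrA (mulrC (_ ^+ n)).
- exists (n + m)%N, (p * q).
  by rewrite tofracM -up -vq exprD mulrACA.
Qed.

HB.instance Definition _ :=
  GRing.isSubringClosed.Build {fraction {poly K}} laurent_pred
    laurent_subring_closed.

(* The ring K[y, y^-1], as the subring of K(y) of all p / y^n. *)
Record laurent : predArgType := Laurent {
  laurent_val : {fraction {poly K}};
  _ : laurent_val \in laurent_pred }.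

HB.instance Definition _ := [isSub for laurent_val].
HB.instance Definition _ := [Choice of laurent by <:].
HB.instance Definition _ := [SubChoice_isSubComNzRing of laurent by <:].

Fact poly_laurent_subproof (p : {poly K}) :
  FracField.tofrac p \in laurent_pred.
Proof. by apply/asboolP; exists 0%N, p; rewrite expr0 mulr1. Qed.

Definition poly_laurent (p : {poly K}) : laurent :=
  Laurent (poly_laurent_subproof p).

Fact poly_laurent_is_zmod_morphism : zmod_morphism poly_laurent.
Proof. by move=> p q; apply: val_inj; rewrite /= tofracB. Qed.

Fact poly_laurent_is_monoid_morphism : monoid_morphism poly_laurent.
Proof.
by split=> [|p q]; apply: val_inj; rewrite /= (tofrac1, tofracM).
Qed.

HB.instance Definition _ :=
  GRing.isZmodMorphism.Build {poly K} laurent poly_laurent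
    poly_laurent_is_zmod_morphism.
HB.instance Definition _ :=
  GRing.isMonoidMorphism.Build {poly K} laurent poly_laurent
    poly_laurent_is_monoid_morphism.

End Laurent.

Section QpolyXn.
Variables (B : comNzRingType) (k : nat).

Fact coef_in_qpolyXn (p : {poly B}) i :
  (in_qpoly 'X^k p : {poly B})`_i = if (i < k.-1.+1)%N then p`_i else 0.
Proof.
by rewrite /= mk_monic_Xn -Pdiv.RingMonic.take_poly_rmodp coef_take_poly.
Qed.

Fact coef_qpolyXnM (p q : {poly %/ ('X^k : {poly B})}) i :
  (p * q : {poly %/ ('X^k : {poly B})})`_i =
  if (i < k.-1.+1)%N then ((p : {poly B}) * q)`_i else 0.
Proof. exact: coef_in_qpolyXn. Qed.

End QpolyXn.

Section Rings.
Variables (K : fieldType) (k : nat).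

(* K[x, y] / (x^k) as K[y][x] / (x^k), and F = R_y as K[y, y^-1][x] / (x^k),
   both for k > 0.  The outer variable is x and the inner one is y. *)
Definition hyperR : comNzRingType := {poly %/ ('X^k : {poly {poly K}})}.
Definition hyperF : comNzRingType := {poly %/ ('X^k : {poly (laurent K)})}.

Definition xR : hyperR := in_qpoly 'X^k 'X.
Definition yR : hyperR := qpolyC 'X^k 'X.

(* deg x = 1 and deg y = -1: r`_a`_b is the coefficient of x^a y^b, whose
   degree is a - b. *)
Definition homogR (d : int) (r : hyperR) : Prop :=
  forall a b : nat,
    ((r : {poly {poly K}})`_a)`_b != 0 -> a%:Z - b%:Z = d.

(* In degree d the coefficient of x^a is a multiple of y^(a - d). *)
Definition homogF (d : int) (f : hyperF) : Prop :=
  forall a : nat, exists c : K,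
    laurent_val (f : {poly (laurent K)})`_a =
      FracField.tofrac c%:P * FracField.tofrac 'X ^ (a%:Z - d).

Definition locR (r : hyperR) : hyperF :=
  in_qpoly 'X^k (map_poly (@poly_laurent K) (r : {poly {poly K}})).

Fact locR_is_zmod_morphism : zmod_morphism locR.
Proof. by move=> p q; rewrite /locR /= !raddfB. Qed.

Fact locR_is_monoid_morphism : monoid_morphism locR.
Proof.
split=> [|p q]; first by rewrite /locR /= rmorph1 in_qpoly1.
rewrite /locR -in_qpolyM -rmorphM; apply: val_inj; apply/polyP => i.
rewrite !coef_in_qpolyXn; case: ifP => // lt_ik.
by rewrite !coef_map coef_qpolyXnM lt_ik.
Qed.

HB.instance Definition _ :=
  GRing.isZmodMorphism.Build hyperR hyperF locR locR_is_zmod_morphism.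
HB.instance Definition _ :=
  GRing.isMonoidMorphism.Build hyperR hyperF locR locR_is_monoid_morphism.

Fact homogR0 d : homogR d 0.
Proof. by move=> a b; rewrite /= !coef0 eqxx. Qed.

Fact homogRB d u v : homogR d u -> homogR d v -> homogR d (u - v).
Proof.
move=> hu hv a b; rewrite /= !coefB => nz; apply/eqP; apply: contraNT nz => ne.
have [zu|/hu/eqP] := eqVneq ((u : {poly {poly K}})`_a)`_b 0; last first.
  by rewrite (negbTE ne).
have [zv|/hv/eqP] := eqVneq ((v : {poly {poly K}})`_a)`_b 0; last first.
  by rewrite (negbTE ne).
by rewrite zu zv subrr.
Qed.

Fact homogRM c d r u : homogR c r -> homogR d u -> homogR (c + d) (r * u).
Proof.
move=> hr hu a b; rewrite coef_qpolyXnM; case: ifP => [_|]; last by rewrite coef0 eqxx.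
rewrite coefM coef_sum => nz; apply/eqP; apply: contraNT nz => ne.
rewrite big1 // => i _; rewrite coefM big1 // => j _; apply/eqP.
rewrite mulf_eq0; apply: contraNT ne; rewrite negb_or => /andP[/hr <- /hu <-].
have lei : (i <= a)%N by rewrite -ltnS.
have lej : (j <= b)%N by rewrite -ltnS.
by rewrite -!subzn // opprB !addrA; apply/eqP; lia.
Qed.

Fact homogRX d r n : homogR d r -> homogR (d *+ n) (r ^+ n).
Proof.
move=> hr; elim: n => [|n IHn]; last by rewrite mulrS exprS; apply: homogRM.
move=> a b; rewrite mulr0n expr0 /= coefC.
have [->|_] := eqVneq a 0%N; last by rewrite coef0 eqxx.
by rewrite coefC; have [->|_] := eqVneq b 0%N; rewrite ?eqxx.
Qed.

Fact homogR_x : homogR 1 xR.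
Proof.
move=> a b; rewrite coef_in_qpolyXn coefX; case: ifP => _; last first.
  by rewrite coef0 eqxx.
have [->|_] := eqVneq a 1%N; last by rewrite coef0 eqxx.
by rewrite coefC; have [->|_] := eqVneq b 0%N; rewrite ?eqxx // subr0.
Qed.

Fact homogR_y : homogR (-1) yR.
Proof.
move=> a b; rewrite /= coefC.
have [->|_] := eqVneq a 0%N; last by rewrite coef0 eqxx.
by rewrite coefX; have [->|_] := eqVneq b 1%N; rewrite ?eqxx // sub0r.
Qed.

Definition monomR (c : K) (a b : nat) : hyperR :=
  in_qpoly 'X^k ((c *: 'X^b) *: 'X^a).

Fact homogR_monom c a b : homogR (a%:Z - b%:Z) (monomR c a b).
Proof.
move=> i j; rewrite coef_in_qpolyXn; case: ifP => [_|]; last by rewrite coef0 eqxx.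
rewrite coefZ coefXn; have [->|_] := eqVneq i a; last first.
  by rewrite mulr0 coef0 eqxx.
by rewrite mulr1 coefZ coefXn; have [->|_] := eqVneq j b; rewrite // mulr0 eqxx.
Qed.

Fact homogR_gen (r : hyperR) : exists cs : seq hyperR,
  (forall c, c \in cs -> exists d, homogR d c) /\ r = \sum_(c <- cs) c.
Proof.
set p : {poly {poly K}} := r.
have rE : r = \sum_(a < size p) \sum_(b < size p`_a) monomR (p`_a)`_b a b.
  have -> : r = in_qpoly 'X^k p.
    by apply: val_inj; symmetry; apply: in_qpoly_small; apply: size_mk_monic.
  rewrite -[in LHS](coefK p) poly_def raddf_sum /=; apply: eq_bigr => a _.
  rewrite -[in LHS](coefK p`_a) poly_def scaler_suml raddf_sum /=.
  by apply: eq_bigr.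
exists (flatten [seq [seq monomR (p`_(val a))`_(val b) (val a) (val b) |
           b <- enum 'I_(size p`_(val a))] | a <- enum 'I_(size p)]).
split=> [c /flattenP[s /mapP[a _ ->] /mapP[b _ ->]]|].
  by exists ((val a)%:Z - (val b)%:Z); apply: homogR_monom.
rewrite big_flatten /= big_map rE big_enum /=; apply: eq_bigr => a _.
by rewrite big_map big_enum.
Qed.

Fact homogR_indep (s : seq int) (c : int -> hyperR) :
  uniq s -> (forall d, homogR d (c d)) -> \sum_(d <- s) c d = 0 ->
  forall d, d \in s -> c d = 0.
Proof.
move=> us hc s0 d ds; apply: val_inj; apply/polyP => a; apply/polyP => b.
rewrite /= !coef0; apply/eqP; apply/negPn/negP => nz.
have dE := hc _ _ _ nz.
have := congr1 (fun r : hyperR => ((r : {poly {poly K}})`_a)`_b) s0.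
rewrite poly_of_qpoly_sum !coef_sum (bigD1_seq d) //= big1 => [|e ne].
  by rewrite addr0 !coef0 => /eqP; rewrite (negbTE nz).
by apply/eqP; apply: contraNT ne => /hc <-; rewrite dE.
Qed.

(* gdeg d is the degree d part; the last two fields say that the module is the
   direct sum of these parts. *)
Record gmod := GMod {
  gsort :> lmodType hyperR;
  gdeg : int -> gsort -> Prop;
  gdeg0 : forall d, gdeg d 0;
  gdegB : forall d u v, gdeg d u -> gdeg d v -> gdeg d (u - v);
  gdegZ : forall c d r u, homogR c r -> gdeg d u -> gdeg (c + d) (r *: u);
  gdeg_gen : forall u, exists cs : seq gsort,
    (forall c, c \in cs -> exists d, gdeg d c) /\ u = \sum_(c <- cs) c;
  gdeg_indep : forall (s : seq int) (c : int -> gsort),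
    uniq s -> (forall d, gdeg d (c d)) -> \sum_(d <- s) c d = 0 ->
    forall d, d \in s -> c d = 0
}.

Record ghom (M N : gmod) := GHom {
  ghom_fun :> {linear M -> N};
  ghom_deg : forall d u, gdeg d u -> gdeg d (ghom_fun u)
}.

Definition giso (M N : gmod) : Prop := exists f : ghom M N, bijective f.

Section Shift.
Variables (M : gmod) (j : int).

Fact gshift_degZ c d r (u : M) :
  homogR c r -> gdeg (d + j) u -> gdeg (c + d + j) (r *: u).
Proof. by move=> hr hu; rewrite -addrA; apply: gdegZ. Qed.

Fact gshift_gen (u : M) : exists cs : seq M,
  (forall c, c \in cs -> exists d, gdeg (d + j) c) /\ u = \sum_(c <- cs) c.
Proof.
have [cs [hcs uE]] := gdeg_gen u; exists cs; split=> // c /hcs[d hd].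
by exists (d - j); rewrite subrK.
Qed.

Fact gshift_indep (s : seq int) (c : int -> M) :
  uniq s -> (forall d : int, gdeg (d + j) (c d)) -> \sum_(d <- s) c d = 0 ->
  forall d, d \in s -> c d = 0.
Proof.
move=> us hc s0 d ds.
rewrite -(addrK j d).
apply: (@gdeg_indep M [seq e + j | e <- s] (fun e => c (e - j))).
- by rewrite map_inj_uniq //; apply: addIr.
- by move=> e; have := hc (e - j); rewrite subrK.
- by rewrite big_map -[RHS]s0; apply: eq_bigr => e _; rewrite addrK.
- exact: map_f.
Qed.

Definition gshift : gmod :=
  @GMod M (fun d => @gdeg M (d + j)) (fun d => gdeg0 M (d + j))
    (fun d => @gdegB M (d + j)) gshift_degZ gshift_gen gshift_indep.
End Shift.

Section Sum.
Variables M N : gmod.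
Implicit Types u v : (M * N)%type.

Definition gsum_deg d u : Prop := gdeg d u.1 /\ gdeg d u.2.

Fact gsum_deg0 d : gsum_deg d 0.
Proof. by split; apply: gdeg0. Qed.

Fact gsum_degB d u v : gsum_deg d u -> gsum_deg d v -> gsum_deg d (u - v).
Proof. by move=> [? ?] [? ?]; split; apply: gdegB. Qed.

Fact gsum_degZ c d r u : homogR c r -> gsum_deg d u -> gsum_deg (c + d) (r *: u).
Proof. by move=> hr [? ?]; split; apply: gdegZ. Qed.

Fact gsum_gen u : exists cs : seq (M * N),
  (forall c, c \in cs -> exists d, gsum_deg d c) /\ u = \sum_(c <- cs) c.
Proof.
case: u => m n.
have [[cs [hcs ->]] [ds [hds ->]]] := (gdeg_gen m, gdeg_gen n).
exists ([seq (c, 0) | c <- cs] ++ [seq (0, c) | c <- ds]); split=> [c|].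
  rewrite mem_cat => /orP[] /mapP[e].
    by move=> /hcs[d hd] ->; exists d; split=> //; apply: gdeg0.
  by move=> /hds[d hd] ->; exists d; split=> //; apply: gdeg0.
rewrite big_cat /= !big_map; congr pair => /=.
  rewrite !raddf_sum /= [X in _ + X]big1 ?addr0 //; exact: eq_bigr.
rewrite !raddf_sum /= [X in X + _]big1 ?add0r //; exact: eq_bigr.
Qed.

Fact gsum_indep (s : seq int) (c : int -> M * N) :
  uniq s -> (forall d, gsum_deg d (c d)) -> \sum_(d <- s) c d = 0 ->
  forall d, d \in s -> c d = 0.
Proof.
move=> us hc s0 d ds.
have c1 : (c d).1 = 0.
  apply: (@gdeg_indep M s (fun d => (c d).1)) => // [e|]; first by case: (hc e).
  by rewrite -(raddf_sum fst) s0.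
have c2 : (c d).2 = 0.
  apply: (@gdeg_indep N s (fun d => (c d).2)) => // [e|]; first by case: (hc e).
  by rewrite -(raddf_sum snd) s0.
by case: (c d) c1 c2 => /= u v -> ->.
Qed.

Definition gsum : gmod :=
  @GMod (M * N)%type gsum_deg gsum_deg0 gsum_degB gsum_degZ gsum_gen gsum_indep.

End Sum.

Section GradedIdeal.
Variables (n : nat) (g : 'I_n -> hyperR).
Hypothesis g_homog : forall i, exists d, homogR d (g i).

Definition gideal_deg (d : int) (u : ideal g) : Prop := homogR d (ideal_val u).

Fact gideal_deg0 d : gideal_deg d 0.
Proof. exact: homogR0. Qed.

Fact gideal_degB d u v :
  gideal_deg d u -> gideal_deg d v -> gideal_deg d (u - v).
Proof. exact: homogRB. Qed.

Fact gideal_degZ c d r u :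
  homogR c r -> gideal_deg d u -> gideal_deg (c + d) (r *: u).
Proof. exact: homogRM. Qed.

Fact gideal_gen (u : ideal g) : exists cs : seq (ideal g),
  (forall c, c \in cs -> exists d, gideal_deg d c) /\ u = \sum_(c <- cs) c.
Proof.
have [c uE] : exists c : 'I_n -> hyperR, ideal_val u = \sum_i c i * g i.
  by case: u => r /= /asboolP.
have mul_in r i : (r * g i : hyperR^o) \in ideal_pred g.
  apply/asboolP; exists (fun j => if j == i then r else 0).
  rewrite (bigD1 i) //= eqxx big1 ?addr0 // => j /negbTE ->.
  by rewrite mul0r.
pose e r i : ideal g := Ideal (mul_in r i).
pose hs i := projT1 (cid (homogR_gen (c i))).
have hsP i : (forall r, r \in hs i -> exists d, homogR d r) /\
             c i = \sum_(r <- hs i) r.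
  exact: projT2 (cid (homogR_gen (c i))).
exists (flatten [seq [seq e r i | r <- hs i] | i <- enum 'I_n]).
split=> [v /flattenP[s /mapP[i _ ->] /mapP[r /(proj1 (hsP i))[d hr] ->]]|].
  by have [d' hg] := g_homog i; exists (d + d'); apply: homogRM.
apply: val_inj; rewrite big_flatten /= big_map ideal_val_sum uE big_enum /=.
apply: eq_bigr => i _; rewrite big_map ideal_val_sum [in LHS](proj2 (hsP i)).
by rewrite mulr_suml.
Qed.

Fact gideal_indep (s : seq int) (c : int -> ideal g) :
  uniq s -> (forall d, gideal_deg d (c d)) -> \sum_(d <- s) c d = 0 ->
  forall d, d \in s -> c d = 0.
Proof.
move=> us hc s0 d ds; apply: val_inj => /=.
apply: (@homogR_indep s (fun d => ideal_val (c d))) => //.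
by rewrite -ideal_val_sum s0.
Qed.

Definition gideal : gmod :=
  GMod gideal_deg0 gideal_degB gideal_degZ gideal_gen gideal_indep.

End GradedIdeal.

(* Ext is the ungraded one over R: on finitely generated graded modules it is
   the sum of the graded pieces. *)
Definition MCM (M : gmod) : Prop :=
  finitely_generated M /\
  forall i, (0 < i)%N -> Ext_eq0 i M hyperR^o.

(* [T] with [eta] is the F-module M (x)_R F: the universal F-module receiving
   an R-linear map from M, where eta m stands for m (x) 1. *)
Definition is_base_change (M : lmodType hyperR) (T : lmodType hyperF)
    (eta : {linear M -> T | locR \; *:%R}) : Prop :=
  forall (U : lmodType hyperF) (h : {linear M -> U | locR \; *:%R}),
    (exists h' : {linear T -> U}, forall m, h' (eta m) = h m) /\
    (forall h1 h2 : {linear T -> U},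
       (forall m, h1 (eta m) = h2 (eta m)) -> forall t, h1 t = h2 t).

(* 'rV_n with these degrees is the graded free module (+)_s F(j s). *)
Definition generically_free (n : nat) (M : gmod) : Prop :=
  exists (j : 'I_n -> int)
         (eta : {linear M -> 'rV[hyperF]_n | locR \; *:%R}),
    is_base_change eta /\
    forall d u, gdeg d u -> forall s, homogF (d + j s) (eta u 0 s).

Section Extensions.
Variables I J : gmod.

Record extension := Extension {
  ext_mid : gmod;
  ext_in : ghom J ext_mid;
  ext_out : ghom ext_mid I;
  ext_inj : injective ext_in;
  ext_surj : forall u, exists e, ext_out e = u;
  ext_exact : forall e, ext_out e = 0 <-> exists v, e = ext_in v
}.

Definition ext_equiv (E E' : extension) : Prop :=
  exists f : ghom (ext_mid E) (ext_mid E'),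
    [/\ bijective f, forall v, f (ext_in E v) = ext_in E' v
      & forall e, ext_out E' (f e) = ext_out E e].

Fact split_in_linear : linear (fun v : J => (v, 0) : gsum J I).
Proof. by move=> r u v; congr pair; rewrite /= scaler0 addr0. Qed.

Definition split_in_lin : {linear J -> gsum J I} :=
  HB.pack_for {linear J -> gsum J I} (fun v : J => (v, 0) : gsum J I)
    (GRing.isLinear.Build hyperR J (gsum J I) *:%R _ split_in_linear).

Fact split_in_deg d u : gdeg d u -> gdeg d (split_in_lin u).
Proof. by split=> //; apply: gdeg0. Qed.

Definition split_in : ghom J (gsum J I) := GHom split_in_deg.

Fact split_out_linear : linear (fun e : gsum J I => e.2).
Proof. by []. Qed.

Definition split_out_lin : {linear gsum J I -> I} :=
  HB.pack_for {linear gsum J I -> I} (fun e : gsum J I => e.2)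
    (GRing.isLinear.Build hyperR (gsum J I) I *:%R _ split_out_linear).

Fact split_out_deg d e : gdeg d e -> gdeg d (split_out_lin e).
Proof. by case. Qed.

Definition split_out : ghom (gsum J I) I := GHom split_out_deg.

Fact split_in_inj : injective split_in.
Proof. by move=> u v []. Qed.

Fact split_out_surj u : exists e, split_out e = u.
Proof. by exists (0, u). Qed.

Fact split_exact e : split_out e = 0 <-> exists v, e = split_in v.
Proof.
split=> [|[v ->] //]; case: e => u v /= ->; by exists u.
Qed.

Definition split_extension : extension :=
  Extension split_in_inj split_out_surj split_exact.

(* Ext^1 in the exact category C is the space of equivalence classes of
   extensions with middle term in C; its zero is the class of the split one. *)
Definition Ext1_eq0 (C : gmod -> Prop) : Prop :=
  forall E : extension, C (ext_mid E) -> ext_equiv E split_extension.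

End Extensions.

(* The module (x^(k-1), x^(k-2) y^(i_1), ..., y^(i_(k-1)))(i_k) is encoded by
   the tuple i = (i_1, ..., i_(k-1)) and the integer ik = i_k; i_0 is 0. *)
Section StandardModule.
Variables (i : k.-1.-tuple nat) (ik : int).

Definition std_exp (s : nat) : nat := nth 0%N (0%N :: i) s.

Definition std_gen (s : 'I_k) : hyperR := xR ^+ (k.-1 - s) * yR ^+ std_exp s.

Fact std_gen_homog (s : 'I_k) : exists d, homogR d (std_gen s).
Proof.
eexists; apply: homogRM; apply: homogRX; first exact: homogR_x.
exact: homogR_y.
Qed.

Definition std_module : gmod := gshift (gideal std_gen_homog) ik.

(* For s = k-1, ..., 0: -i_k - i_(k-1), -i_k - i_(k-2) + 1, ..., -i_k + k-1. *)
Definition std_index : {fset int} :=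
  [fset (- ik - (std_exp s)%:Z + (k.-1 - s)%N%:Z)%R | s in iota 0 k]%fset.

End StandardModule.

(* L is the k-subset attached to M, i.e. the index of its Pluecker coordinate.
   Every generically free MCM module of rank 1 is isomorphic to exactly one
   standard module, so that L is then a function of M. *)
Definition pluecker_index (M : gmod) (L : {fset int}) : Prop :=
  exists (i : k.-1.-tuple nat) (ik : int),
    [/\ sorted leq i, giso M (std_module i ik) & L = std_index i ik].

End Rings.

Definition crossing (A B : {fset int}) : Prop :=
  exists a1 a2 b1 b2 : int,
    [/\ a1 \in (A `\` B)%fset, a2 \in (A `\` B)%fset,
        b1 \in (B `\` A)%fset, b2 \in (B `\` A)%fset
      & (a1 < b1 < a2) && (a2 < b2) \/ (b1 < a1 < b2) && (b2 < a2)].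

(* Compatibility of the Pluecker coordinates p_A and p_B. *)
Definition noncrossing (A B : {fset int}) : Prop := ~ crossing A B.

(* Main.v *)
From HB Require Import structures.
Require Import Defs.
From mathcomp Require Import all_boot all_order all_algebra.
From mathcomp Require Import finmap reals complex.
From mathcomp Require Import zify boolp.

Set Implicit Arguments.
Unset Strict Implicit.
Unset Printing Implicit Defensive.

Import Order.TTheory GRing.Theory Num.Theory.
Local Open Scope ring_scope.

(* With the index set A = {a_0 < ... < a_(k-1)} of I, the module I has a
   homogeneous K[y]-basis e_j of degree a_j on which x acts as a Jordan chain
   e_j |-> y^(a_(j+1) - a_j - 1) e_(j+1); likewise J with B and f_i.  After
   setting y = 1, an extension of I by J is a k x k matrix D with D_ij = 0
   unless a_j < b_i, and it splits iff D_ij = h_(i,j+1) - h_(i-1,j) for some h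
   with h_ij = 0 unless a_j <= b_i.  This decouples into the diagonals of the
   matrices, and an obstruction survives on the diagonal i - j = c iff two
   forced zeros of h are separated by a possible jump (for c < 0 the roles of A
   and B are exchanged), which over all c says exactly that A and B cross.
   Every extension is free over K[y], hence maximal Cohen-Macaulay because R is
   a Frobenius K[y]-algebra. *)

(** * Modules over K[y][x]/(x^k) *)

Section HyperR.
Variables (K : fieldType) (k : nat).
Hypothesis k_gt1 : (1 < k)%N.
Let k_gt0 : (0 < k)%N := ltnW k_gt1.
Local Notation R := (hyperR K k).
Implicit Types (r s : R) (p q : {poly K}).

(** The diagonals decouple because both entries of h in D_ij = h_(i,j+1) - h_(i-1,j) lie on one
    diagonal. Counting explains the two cases. For c >= 0 the diagonal i - j = c of h has one entry
    more than it has equations: h is a partial sum of D up to a free constant, and only two forced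
    zeros with a jump between them can obstruct. For c < 0 it has one equation more than entries:
    both ends are pinned, the surplus equation holds because x^k = 0 makes the matching diagonal of
    D sum to 0, and one forced zero between two jumps obstructs. Exchanging A and B turns the second
    pattern into the first. The other obstacle is [MCM], which quantifies over all projective
    resolutions, whose terms are only known to lift R-linear maps. Coinduction from K[y] yields
    lifts of K[y]-linear maps too, so a resolution of a K[y]-free module splits over K[y]; cocycles
    into R then bound K[y]-linearly, and the trace makes the bounding map R-linear. This serves the
    extensions constructed to be non-split; in the other direction every extension of I by J splits,
    whatever its middle term. *)

Definition polyR (p : {poly K}) : R := qpolyC 'X^k p.

HB.instance Definition _ := GRing.RMorphism.copy polyR (qpolyC ('X^k : {poly {poly K}})).

Lemma coef_hyperR_ge r a : (k <= a)%N -> (r : {poly {poly K}})`_a = 0.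
Proof.
move=> le_ka; apply: nth_default; apply: leq_trans le_ka; rewrite -ltnS.
apply: leq_trans (size_mk_monic r) _.
by rewrite mk_monic_Xn size_polyXn prednK.
Qed.

Lemma hyperR_ext r s :
  (forall a, (a < k)%N -> (r : {poly {poly K}})`_a = (s : {poly {poly K}})`_a) ->
  r = s.
Proof.
move=> rs; apply: val_inj; apply/polyP => a.
by have [/rs//|le_ka] := ltnP a k; rewrite !coef_hyperR_ge.
Qed.

Lemma coef_polyR_mul p r a :
  (polyR p * r : {poly {poly K}})`_a = p * (r : {poly {poly K}})`_a.
Proof.
have [lt_ak|le_ka] := ltnP a k; last by rewrite !coef_hyperR_ge ?mulr0.
by rewrite coef_qpolyXnM prednK // lt_ak /= coefCM.
Qed.

Lemma coef_xRX n a : ((xR K k ^+ n : R) : {poly {poly K}})`_a =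
  ((a == n) && (a < k)%N)%:R.
Proof.
have -> : xR K k ^+ n = in_qpoly 'X^k 'X^n.
  rewrite /xR; elim: n => [|n IHn]; first by rewrite !expr0 in_qpoly1.
  by rewrite !exprS IHn in_qpolyM.
rewrite coef_in_qpolyXn prednK // coefXn; case: ltnP; by rewrite ?andbT ?andbF.
Qed.

Lemma coef_mul_xRX r n a : (a < k)%N ->
  (r * xR K k ^+ n : {poly {poly K}})`_a =
  if (n <= a)%N then (r : {poly {poly K}})`_(a - n) else 0.
Proof.
move=> lt_ak; rewrite coef_qpolyXnM prednK // lt_ak coefM.
have [le_na|lt_an] := leqP n a; last first.
  rewrite big1 // => i _; rewrite coef_xRX; case: eqP => [ian|_]; rewrite ?mulr0 //.
  by move: lt_an; rewrite -ian ltnNge leq_subr.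
have lt_s : (a - n < a.+1)%N by rewrite ltnS leq_subr.
rewrite (bigD1 (Ordinal lt_s)) //= big1 => [|i ne_i]; rewrite coef_xRX.
  by rewrite subKn // eqxx (leq_ltn_trans le_na) // mulr1 addr0.
case: eqP => [ian|_]; last by rewrite mulr0.
by case/eqP: ne_i; apply: val_inj => /=; move: (ltn_ord i); lia.
Qed.

Lemma xRk_eq0 : xR K k ^+ k = 0.
Proof.
by apply: hyperR_ext => a lt_ak; rewrite coef_xRX lt_ak andbT ltn_eqF // coef0.
Qed.

Lemma hyperR_expand r :
  r = \sum_(a < k) polyR (r : {poly {poly K}})`_a * xR K k ^+ a.
Proof.
apply: hyperR_ext => a lt_ak; rewrite poly_of_qpoly_sum coef_sum.
rewrite (bigD1 (Ordinal lt_ak)) //= big1 => [|b neq_ba].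
  by rewrite coef_polyR_mul coef_xRX eqxx lt_ak mulr1 addr0.
rewrite coef_polyR_mul coef_xRX; case: eqP => [ab|]; last by rewrite mulr0.
by case/eqP: neq_ba; apply: val_inj.
Qed.

Lemma yRXE n : yR K k ^+ n = polyR 'X^n.
Proof. by rewrite /yR -/(polyR 'X) -rmorphXn. Qed.

Lemma homogR_polyR d p :
  (forall n, p`_n != 0 -> - n%:Z = d) -> homogR d (polyR p).
Proof.
move=> hp a b; rewrite /= coefC; have [->|_] := eqVneq a 0%N.
  by move/hp <-; rewrite sub0r.
by rewrite coef0 eqxx.
Qed.

Section PolyLinear.
Variables U V : lmodType R.

Definition poly_linear (f : U -> V) : Prop :=
  forall p u v, f (polyR p *: u + v) = polyR p *: f u + f v.

Variable f : U -> V.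
Hypothesis f_lin : poly_linear f.

Lemma poly_linearD u v : f (u + v) = f u + f v.
Proof. by have := f_lin 1 u v; rewrite rmorph1 !scale1r. Qed.

Lemma poly_linear0 : f 0 = 0.
Proof. by apply: (addrI (f 0)); rewrite -poly_linearD !addr0. Qed.

Lemma poly_linearZ p u : f (polyR p *: u) = polyR p *: f u.
Proof. by have := f_lin p u 0; rewrite poly_linear0 !addr0. Qed.

Lemma poly_linear_sum (T : Type) (s : seq T) (P : pred T) (u : T -> U) :
  f (\sum_(t <- s | P t) u t) = \sum_(t <- s | P t) f (u t).
Proof. exact: (big_morph f poly_linearD poly_linear0). Qed.

Lemma poly_linear_linear :
  (forall u, f (xR K k *: u) = xR K k *: f u) -> linear f.
Proof.
move=> f_x; have f_xn n u : f (xR K k ^+ n *: u) = xR K k ^+ n *: f u.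
  elim: n => [|n IHn] in u *; first by rewrite expr0 !scale1r.
  by rewrite exprS -!scalerA f_x IHn.
move=> r u v; rewrite poly_linearD; congr (_ + _).
rewrite (hyperR_expand r) !scaler_suml poly_linear_sum; apply: eq_bigr => a _.
by rewrite -!scalerA poly_linearZ f_xn.
Qed.

End PolyLinear.

Lemma iter_poly_linear (V : lmodType R) (f : V -> V) n :
  poly_linear f -> poly_linear (iter n f).
Proof. by move=> f_lin; elim: n => [|n IHn] p u v //=; rewrite IHn; apply: f_lin. Qed.

(* Replaces the action of x on an R-module by another nilpotent one. *)
Section Twist.
Variable V : lmodType R.

Record xaction := XAction {
  xact :> V -> V;
  xact_lin : poly_linear xact;
  xact_nil : forall v, iter k xact v = 0
}.

(** The carrier is [V]; the arguments record, for instance inference, which action of x the module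
    structure uses and the bound on k in its laws. *)
Definition twisted (_ : (1 < k)%N) (X : xaction) : Type := V.

Variable X : xaction.
HB.instance Definition _ := GRing.Zmodule.copy (twisted k_gt1 X) V.

Definition twisted_scale r (v : twisted k_gt1 X) : twisted k_gt1 X :=
  \sum_(a < k) polyR (r : {poly {poly K}})`_a *: iter a X v.

Lemma iter_xact_lin n : poly_linear (iter n X).
Proof. exact/iter_poly_linear/xact_lin. Qed.

Lemma iter_xact_ge n v : (k <= n)%N -> iter n X v = 0.
Proof.
move=> le_kn; rewrite -(subnK le_kn) iterD xact_nil.
exact/poly_linear0/iter_xact_lin.
Qed.

(** Both sides are the convolution over pairs (a, b) acting through [iter (a + b) X]. The pairs with
    a + b >= k, discarded by multiplication modulo x^k, vanish because [X] is nilpotent. *)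
Lemma twisted_scaleA r s v :
  twisted_scale r (twisted_scale s v) = twisted_scale (r * s) v.
Proof.
rewrite /twisted_scale.
under eq_bigr => a _.
  rewrite (poly_linear_sum (iter_xact_lin a)) scaler_sumr.
  under eq_bigr => b _ do rewrite (poly_linearZ (iter_xact_lin a)) -iterD scalerA -rmorphM.
  over.
have -> : \sum_(c < k) polyR (r * s : {poly {poly K}})`_c *: iter c X v =
  \sum_(c < k) \sum_(a < k | (a <= c)%N)
     polyR ((r : {poly {poly K}})`_a * (s : {poly {poly K}})`_(c - a))
       *: (iter c X v : V).
  apply: eq_bigr => c _; rewrite -scaler_suml -rmorph_sum; congr (polyR _ *: _).
  rewrite coef_qpolyXnM prednK // ltn_ord coefM.
  rewrite (big_ord_widen k (fun a => (r : {poly {poly K}})`_a *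
    (s : {poly {poly K}})`_(c - a)) (ltn_ord c)) //.
rewrite [RHS](exchange_big_dep predT) //=; apply: eq_bigr => a _.
rewrite -(big_mkord predT (fun b => polyR ((r : {poly {poly K}})`_a *
   (s : {poly {poly K}})`_b) *: (iter (a + b) X v : V))).
rewrite -(big_mkord (fun c => a <= c)%N (fun c => polyR ((r : {poly {poly K}})`_a *
   (s : {poly {poly K}})`_(c - a)) *: (iter c X v : V))).
have le_ak := ltnW (ltn_ord a).
rewrite (big_cat_nat (leq0n _) (leq_subr a k)) //= [X in _ + X]big_nat_cond.
rewrite [X in _ + X]big1 ?addr0; last first.
  by move=> b; rewrite andbT leq_subLR => /andP[le_k _]; rewrite iter_xact_ge ?scaler0.
rewrite [RHS](big_cat_nat (leq0n _) le_ak) //= [X in _ = X + _]big_nat_cond.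
rewrite [X in _ = X + _]big1 ?add0r; last first.
  by move=> b; rewrite /= ltnNge; case: leqP.
rewrite -[X in _ = \sum_(X <= _ < _ | _) _]add0n big_addn.
by apply: eq_big => b; [rewrite leq_addl|rewrite addnK addnC].
Qed.

Lemma twisted_scale1 v : twisted_scale 1 v = v.
Proof.
rewrite /twisted_scale (bigD1 (Ordinal k_gt0)) //= big1 => [|a ne_a0].
  by rewrite coefC eqxx rmorph1 scale1r addr0.
rewrite /= coefC; have /negbTE -> : val a != 0%N by apply: contra ne_a0.
by rewrite rmorph0 scale0r.
Qed.

Lemma twisted_scaleDr : right_distributive twisted_scale +%R.
Proof.
move=> r u v; rewrite /twisted_scale -big_split; apply: eq_bigr => a _.
by rewrite (poly_linearD (iter_xact_lin a)) scalerDr.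
Qed.

Lemma twisted_scaleDl v : {morph twisted_scale^~ v : r s / r + s}.
Proof.
move=> r s; rewrite /twisted_scale -big_split; apply: eq_bigr => a _.
by rewrite /= coefD rmorphD scalerDl.
Qed.

HB.instance Definition _ := GRing.Zmodule_isLmodule.Build R (twisted k_gt1 X)
  twisted_scaleA twisted_scale1 twisted_scaleDr twisted_scaleDl.

Lemma twisted_polyZ p (v : V) : polyR p *: (v : twisted k_gt1 X) = polyR p *: v.
Proof.
rewrite [LHS]/(twisted_scale _ _) /twisted_scale (bigD1 (Ordinal k_gt0)) //=.
rewrite big1 => [|a ne_a0]; first by rewrite coefC eqxx addr0.
rewrite coefC; have /negbTE -> : val a != 0%N by apply: contra ne_a0.
by rewrite rmorph0 scale0r.
Qed.

Lemma twisted_xZ (v : V) : xR K k *: (v : twisted k_gt1 X) = X v.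
Proof.
rewrite [LHS]/(twisted_scale _ _) /twisted_scale (bigD1 (Ordinal k_gt1)) //=.
have coef_x a : (xR K k : {poly {poly K}})`_a = ((a == 1) && (a < k))%N%:R.
  by rewrite -coef_xRX expr1.
rewrite coef_x k_gt1 rmorph1 scale1r big1 ?addr0 // => a ne_a1.
rewrite coef_x; have /negbTE -> : val a != 1%N by apply: contra ne_a1.
by rewrite rmorph0 scale0r.
Qed.

End Twist.
End HyperR.

(** * Vanishing of Ext into R *)

Section ExtVanishing.
Variables (K : fieldType) (k : nat).
Hypothesis k_gt1 : (1 < k)%N.
Local Notation R := (hyperR K k).


Lemma linear_exists (U V : lmodType R) (f : U -> V) :
  linear f -> exists g : {linear U -> V}, g =1 f.
Proof.
move=> lin_f.
by exists (HB.pack_for {linear U -> V} f (GRing.isLinear.Build R U V *:%R f lin_f)).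
Qed.

Section Coinduced.
Variable U : lmodType R.
Implicit Type f : {ffun 'I_k -> U}.

Definition ffun_ext f n : U := if insub n is Some i then f i else 0.

Lemma ffun_ext_ord f (i : 'I_k) : ffun_ext f i = f i.
Proof. by rewrite /ffun_ext valK. Qed.

Lemma ffun_ext_ge f n : (k <= n)%N -> ffun_ext f n = 0.
Proof. by move=> le_kn; rewrite /ffun_ext insubN // -leqNgt. Qed.

(** Precomposition with multiplication by x: the value at x^i becomes the one at x^(i+1), which is 0
    at the end since x^k = 0. *)
Definition ffun_shift f : {ffun 'I_k -> U} := [ffun i : 'I_k => ffun_ext f i.+1].

Lemma ffun_shift_lin : poly_linear ffun_shift.
Proof.
move=> p f g; apply/ffunP => i; rewrite !ffunE /ffun_ext.
by case: insubP => [j _ _|_]; rewrite ?ffunE // scaler0 addr0.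
Qed.

Lemma ffun_ext_shift f m n : ffun_ext (iter m ffun_shift f) n = ffun_ext f (n + m).
Proof.
elim: m n => [|m IHm] n; first by rewrite addn0.
have [lt_nk|le_kn] := ltnP n k; last
  by rewrite !ffun_ext_ge // (leq_trans le_kn) ?leq_addr.
by rewrite -[n]/(val (Ordinal lt_nk)) ffun_ext_ord /= ffunE IHm addSnnS.
Qed.

Lemma ffun_shift_nil f : iter k ffun_shift f = 0.
Proof.
apply/ffunP => i; rewrite -ffun_ext_ord ffun_ext_shift ffunE.
by rewrite ffun_ext_ge // leq_addl.
Qed.

(* Hom over K[y] from R to U; the value at [i] is the image of [x ^ i]. *)
Definition coind : lmodType R :=
  twisted k_gt1 (XAction ffun_shift_lin ffun_shift_nil).

End Coinduced.

Lemma coind_adjunct (P U : lmodType R) (f : P -> U) : poly_linear f ->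
  exists F : {linear P -> coind U},
    forall u (i : 'I_k), (F u : {ffun 'I_k -> U}) i = f (xR K k ^+ i *: u).
Proof.
move=> f_lin.
pose F u : coind U := [ffun i : 'I_k => f (xR K k ^+ i *: u)].
have [|G GE] := @linear_exists P (coind U) F; last first.
  by exists G => u i; rewrite GE ffunE.
apply: poly_linear_linear => // [p u v|u].
  rewrite twisted_polyZ; apply/ffunP => i.
  by rewrite !ffunE scalerDr scalerA mulrC -scalerA f_lin.
rewrite twisted_xZ; apply/ffunP => i; rewrite !ffunE scalerA -exprSr.
have [lt_ik|le_ki] := ltnP i.+1 k.
  by rewrite -[i.+1]/(val (Ordinal lt_ik)) ffun_ext_ord ffunE.
rewrite ffun_ext_ge // -(subnK le_ki) exprD xRk_eq0 // mulr0 scale0r.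
exact: poly_linear0.
Qed.

Lemma coind_map (U V : lmodType R) (g : U -> V) : poly_linear g ->
  exists G : {linear coind U -> coind V},
    forall (u : {ffun 'I_k -> U}), G u = [ffun i => g (u i)].
Proof.
move=> g_lin.
pose G (u : coind U) : coind V := [ffun i => g ((u : {ffun 'I_k -> U}) i)].
have [|G' G'E] := @linear_exists (coind U) (coind V) G; last by exists G'.
apply: poly_linear_linear => // [p u v|u].
  by rewrite !twisted_polyZ; apply/ffunP => i; rewrite !ffunE g_lin.
rewrite !twisted_xZ; apply/ffunP => i; rewrite !ffunE.
by rewrite /ffun_ext; case: insubP => [j _ _|_]; rewrite ?ffunE // poly_linear0.
Qed.

(** Projectivity lifts only R-linear maps, so the problem is moved to coinduced modules, where [g]
    induces an R-linear surjection; evaluating the lift at x^0 = 1 gives the K[y]-linear one. *)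
Lemma projective_poly_lift (P U V : lmodType R) (g : U -> V) (f : P -> V) :
  projective P -> poly_linear g -> poly_linear f ->
  (forall v, exists u, g u = v) ->
  exists2 h : P -> U, poly_linear h & forall p, g (h p) = f p.
Proof.
move=> projP g_lin f_lin g_surj.
have [G GE] := coind_map g_lin; have [F FE] := coind_adjunct f_lin.
have [v|H HE] := projP _ _ G F.
  exists [ffun i => sval (cid (g_surj ((v : {ffun 'I_k -> V}) i)))].
  by rewrite GE; apply/ffunP => i; rewrite !ffunE; case: cid.
pose i0 := Ordinal (ltnW k_gt1).
exists (fun p => (H p : {ffun 'I_k -> U}) i0) => [p u v|p].
  by rewrite linearP twisted_polyZ !ffunE.
have := congr1 (fun w : {ffun 'I_k -> V} => w i0) (HE p).
by rewrite GE ffunE => ->; rewrite FE expr0 scale1r.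
Qed.

(* One step of a K[y]-linear contracting homotopy of an R-projective resolution. *)
Lemma split_step (A A' B : lmodType R) (d : {linear A -> B}) (d' : {linear A' -> A})
    (s : B -> A) :
  projective A -> poly_linear s -> (forall a, d (s (d a)) = d a) ->
  (forall a, d a = 0 <-> exists a', a = d' a') ->
  exists2 s' : A -> A', poly_linear s' & forall a', d' (s' (d' a')) = d' a'.
Proof.
move=> projA s_lin ds d_ex.
pose g (u : A' * A) := d' u.1 + s (d u.2).
have g_lin : poly_linear g.
  move=> p u v; rewrite /g /= !linearP s_lin scalerDr !addrA. congr (_ + _).
  by rewrite addrAC.
have g_surj v : exists u, g u = v.
  have /d_ex[a' a'E] : d (v - s (d v)) = 0 by rewrite linearB ds subrr.
  by exists (a', v); rewrite /g /= -a'E subrK.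
have [|h h_lin hE] := projective_poly_lift (f := id) projA g_lin _ g_surj; first
  by move=> p u v.
exists (fun a => (h a).1) => [p u v|a']; first by rewrite h_lin.
have := hE (d' a'); rewrite /g => eq_a'.
have d0 : d (d' a') = 0 by apply/d_ex; exists a'.
have dd0 u : d (d' u) = 0 by apply/d_ex; exists u.
(* Applying [d] kills both [d'] terms and leaves [d] of the second component equal to 0, so on
   boundaries the [s] term of [g] disappears. *)
have /esym := congr1 d eq_a'; rewrite d0 linearD dd0 add0r ds => h0.
by rewrite -[RHS]eq_a' -h0 poly_linear0 ?addr0.
Qed.

(* A finite dual basis over K[y], so that [M] is K[y]-projective. *)
Definition poly_dual_basis (M : lmodType R) : Prop :=
  exists (T : finType) (e : T -> M) (co : T -> M -> {poly K}),
    (forall i p u v, co i (polyR k p *: u + v) = p * co i u + co i v) /\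
    forall u, u = \sum_i polyR k (co i u) *: e i.

Lemma poly_dual_basis_section (M U : lmodType R) (g : {linear U -> M}) :
  poly_dual_basis M -> (forall m, exists u, g u = m) ->
  exists2 s : M -> U, poly_linear s & forall m, g (s m) = m.
Proof.
move=> [T [e [co [co_lin coE]]]] g_surj.
exists (fun m => \sum_i polyR k (co i m) *: sval (cid (g_surj (e i)))).
  move=> p u v; rewrite scaler_sumr -big_split; apply: eq_bigr => i _.
  by rewrite co_lin rmorphD rmorphM scalerDl scalerA.
move=> m; rewrite linear_sum [RHS]coE; apply: eq_bigr => i _.
by rewrite linearZ; case: cid => /= ? ->.
Qed.

Lemma resolution_split (M : lmodType R) (P : proj_resolution M) n :
  poly_dual_basis M ->
  exists2 s : pr_mod P n -> pr_mod P n.+1, poly_linear s &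
    forall q, pr_d P n (s (pr_d P n q)) = pr_d P n q.
Proof.
move=> basisM; elim: n => [|n [s s_lin sE]]; last first.
  exact: split_step (@pr_proj _ _ P n.+1) s_lin sE (@pr_exact _ _ P n).
have [s s_lin sE] := poly_dual_basis_section basisM (pr_aug_surj P).
exact: split_step (@pr_proj _ _ P 0%N) s_lin (fun a => sE (pr_aug P a)) (@pr_exact0 _ _ P).
Qed.

(* R is a Frobenius algebra over K[y], the trace being the coefficient of
   x^(k-1): K[y]-linear maps to R differ from R-linear ones by this twist. *)
Lemma frobenius_linearize (M : lmodType R) (psi : M -> R^o) : poly_linear psi ->
  exists g : {linear M -> R^o}, forall m,
    (forall n, psi (xR K k ^+ n *: m) = xR K k ^+ n * psi m) -> g m = psi m.
Proof.
move=> psi_lin.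
pose tr n m := (psi (xR K k ^+ n *: m) : {poly {poly K}})`_k.-1.
(* If psi commutes with powers of x at m, the x^(k-1)-coefficient of psi (x^(k-1-a) m) is the
   x^a-coefficient of psi m, so [g] reassembles psi m. Defined through traces, [g] is R-linear for
   every psi. *)
pose g m : R^o := \sum_(a < k) polyR k (tr (k.-1 - a)%N m) * xR K k ^+ a.
have tr_lin n p u v : tr n (polyR k p *: u + v) = p * tr n u + tr n v.
  rewrite /tr scalerDr scalerA mulrC -scalerA psi_lin poly_of_qpolyD coefD.
  by rewrite -[_ *: psi _]/(polyR k p * psi _) coef_polyR_mul.
have [|G GE] := @linear_exists M R^o g; last first.
  exists G => m psi_m; rewrite GE [RHS](hyperR_expand k_gt1); apply: eq_bigr => a _.
  rewrite /tr psi_m; congr (polyR k _ * _).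
  have k_gt0 := ltnW k_gt1; have le_ak : (a <= k.-1)%N by rewrite -ltnS prednK.
  by rewrite mulrC (coef_mul_xRX k_gt1) ?prednK // leq_subr subKn.
apply: poly_linear_linear => // [p u v|u].
  rewrite /g scaler_sumr -big_split; apply: eq_bigr => a _.
  rewrite tr_lin rmorphD rmorphM mulrDl; congr (_ + _).
  by rewrite -[RHS]/(_ * _) mulrA.
have k_gt0 := ltnW k_gt1.
(* Both sides of commutation with x are shifted sums of [F]. The end terms vanish: [F k] because x^k
   = 0 in R, [F 0] because x^k kills u. *)
pose F a := polyR k (tr (k - a)%N u) * xR K k ^+ a.
have Fk : F k = 0 by rewrite /F (xRk_eq0 K k_gt1) mulr0.
have F0 : F 0%N = 0.
  by rewrite /F /tr subn0 (xRk_eq0 K k_gt1) scale0r poly_linear0 // coef0 rmorph0 mul0r.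
have -> : g (xR K k *: u) = \sum_(0 <= a < k) F a.
  rewrite /g big_mkord; apply: eq_bigr => a _.
  have -> : F a = polyR k (tr (k.-1 - a).+1 u) * xR K k ^+ a.
    by rewrite /F; congr (polyR k (tr _ u) * _); move: (ltn_ord a); lia.
  by rewrite /tr scalerA -exprSr.
have -> : xR K k *: g u = \sum_(0 <= a < k) F a.+1.
  rewrite /g big_mkord scaler_sumr; apply: eq_bigr => a _.
  have -> : F a.+1 = polyR k (tr (k.-1 - a)%N u) * xR K k ^+ a.+1.
    by rewrite /F; congr (polyR k (tr _ u) * _); lia.
  by rewrite exprS mulrCA.
have : \sum_(0 <= a < k) F a + F k = F 0%N + \sum_(0 <= a < k) F a.+1.
  by rewrite -big_nat_recr // big_nat_recl.
by rewrite Fk F0 addr0 add0r.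
Qed.

(** A cocycle satisfies f = (f s) d for the K[y]-linear homotopy s. Since f s commutes with x on the
    image of d, its Frobenius linearisation agrees with it there and is an R-linear bounding map. *)
Lemma Ext_eq0_regular (M : lmodType R) n :
  poly_dual_basis M -> Ext_eq0 n.+1 M R^o.
Proof.
move=> basisM P f f_coc; have [s s_lin sE] := resolution_split P n basisM.
have fs q : f (s (pr_d P n q)) = f q.
  apply/eqP; rewrite -subr_eq0 -linearB.
  have /pr_exact[q' ->] : pr_d P n (s (pr_d P n q) - q) = 0.
    by rewrite linearB sE subrr.
  by rewrite f_coc.
have [|g gE] := @frobenius_linearize _ (f \o s).
  by move=> p u v; rewrite /= s_lin linearP.
exists g => q; rewrite gE /= ?fs // => m.
by rewrite -linearZ fs linearZ.
Qed.

End ExtVanishing.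

(** * Graded modules with a chain basis *)

Section GradedModules.
Variables (K : fieldType) (k : nat).
Local Notation R := (hyperR K k).
Implicit Types (M N : gmod K k).

Lemma gdegN M d (u : M) : gdeg d u -> gdeg d (- u).
Proof. by move=> hu; rewrite -sub0r; apply: gdegB => //; apply: gdeg0. Qed.

Lemma gdegD M d (u v : M) : gdeg d u -> gdeg d v -> gdeg d (u + v).
Proof. by move=> hu hv; rewrite -[v]opprK; apply: gdegB => //; apply: gdegN. Qed.

Lemma gdeg_sum M d (T : Type) (s : seq T) (P : pred T) (u : T -> M) :
  (forall t, P t -> gdeg d (u t)) -> gdeg d (\sum_(t <- s | P t) u t).
Proof. by move=> hu; apply: big_ind => //; [apply: gdeg0 | apply: gdegD]. Qed.

Lemma gdeg_polyX M d n m (u : M) :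
  gdeg d u -> d - n%:Z = m -> gdeg m (polyR k 'X^n *: u).
Proof.
move=> hu <-; rewrite addrC; apply: gdegZ hu.
by apply: homogR_polyR => i; rewrite coefXn; have [->|_] := eqVneq i n; rewrite ?eqxx.
Qed.

Lemma gdeg_polyC M d c (u : M) : gdeg d u -> gdeg d (polyR k c%:P *: u).
Proof.
move=> hu; rewrite -[d]add0r; apply: gdegZ hu.
by apply: homogR_polyR => i; rewrite coefC; have [->|_] := eqVneq i 0; rewrite ?eqxx ?oppr0.
Qed.

Lemma gdecomp M (u : M) : exists (s : seq int) (c : int -> M),
  [/\ uniq s, forall d, gdeg d (c d), forall d, d \notin s -> c d = 0
    & u = \sum_(d <- s) c d].
Proof.
have [cs [cs_homog ->]] := gdeg_gen u.
have [dg dgP] : exists dg : M -> int, forall v, v \in cs -> gdeg (dg v) v.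
  have dgP v : exists d : int, v \in cs -> gdeg d v.
    by have [/cs_homog[d hd]|_] := boolP (v \in cs); [exists d | exists 0].
  by exists (fun v => sval (cid (dgP v))) => v; case: cid.
exists (undup (map dg cs)), (fun d => \sum_(v <- cs | dg v == d) v).
split=> [|d|d|]; first exact: undup_uniq.
- rewrite big_seq_cond; apply: gdeg_sum => v /andP[v_cs /eqP <-].
  exact: dgP.
- rewrite mem_undup => d_notin; rewrite big_seq_cond big1 // => v.
  by case/andP=> v_cs /eqP vd; rewrite -vd map_f in d_notin.
under [RHS]eq_bigr => d _ do rewrite big_mkcond.
rewrite exchange_big /= !big_seq; apply: eq_bigr => v v_cs.
rewrite (bigD1_seq (dg v)) ?undup_uniq ?mem_undup ?map_f //= eqxx.
by rewrite big1 ?addr0 // => d; rewrite eq_sym => /negbTE ->.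
Qed.

(** A degree 0 map sends components to components, and a homogeneous g u is its own component of
    degree d; hence preimages can be chosen homogeneous. *)
Lemma ghom_component M N (g : ghom M N) d u :
  gdeg d (g u) -> exists2 v, gdeg d v & g v = g u.
Proof.
move=> gu_d; have [s [c [s_uniq c_homog c0 uE]]] := gdecomp u.
exists (c d); first exact: c_homog.
pose s' := undup (d :: s).
have uE' : u = \sum_(e <- s') c e.
  rewrite uE /s' /=; case: ifP => [_|/negbT /c0 cd0]; first by rewrite undup_id.
  by rewrite big_cons cd0 add0r undup_id.
apply/eqP; rewrite -subr_eq0; apply/eqP.
pose f e := g (c e) - (if e == d then g u else 0).
have <- : f d = g (c d) - g u by rewrite /f eqxx.
apply: (@gdeg_indep _ _ N s') => [|e||].
- exact: undup_uniq.
- by apply: gdegB; [apply/ghom_deg/c_homog | case: eqP => [->|_] //; apply: gdeg0].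
- rewrite sumrB -linear_sum -uE' -big_mkcond /= -big_filter.
  have -> : [seq e <- s' | e == d] = [:: d].
    rewrite (_ : [seq _ <- _ | _] = filter (pred1 d) s') //.
    by rewrite filter_pred1_uniq ?undup_uniq // mem_undup mem_head.
  by rewrite big_seq1 subrr.
- by rewrite mem_undup mem_head.
Qed.

Lemma ghom_lift M N (g : ghom M N) d v :
  (forall v, exists u, g u = v) -> gdeg d v -> exists2 u, gdeg d u & g u = v.
Proof. by move=> g_surj; have [u <-] := g_surj v; apply: ghom_component. Qed.

Lemma ghom_inj_deg M N (g : ghom M N) d u :
  injective g -> gdeg d (g u) -> gdeg d u.
Proof. by move=> g_inj /ghom_component[v hv /g_inj <-]. Qed.

(* A K[y]-basis of homogeneous elements on which x acts as a single Jordan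
   chain, up to powers of y; [co j] is the [j]-th coordinate. *)
Record chain_basis M (a : nat -> int) (e : nat -> M) (co : nat -> M -> {poly K})
    : Prop := ChainBasis {
  cb_mono : forall i j, (i < j < k)%N -> a i < a j;
  cb_deg : forall j, (j < k)%N -> gdeg (a j) (e j);
  cb_x : forall j, (j.+1 < k)%N ->
    xR K k *: e j = polyR k 'X^(absz (a j.+1 - a j - 1)%R) *: e j.+1;
  cb_xlast : xR K k *: e k.-1 = 0;
  cb_lin : forall j p u v, co j (polyR k p *: u + v) = p * co j u + co j v;
  cb_delta : forall i j, (i < k)%N -> (j < k)%N -> co i (e j) = (i == j)%:R;
  cb_span : forall u, u = \sum_(j < k) polyR k (co j u) *: e j;
  cb_homog : forall d u, gdeg d u -> forall j n, (j < k)%N ->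
    (co j u)`_n != 0 -> a j - n%:Z = d
}.

Lemma chain_basis_iso M N (f : ghom M N) a e co :
  bijective f -> @chain_basis N a e co ->
  exists e' co', @chain_basis M a e' co'.
Proof.
case=> g fK gK cb; have f_inj := can_inj fK.
exists (g \o e), (fun j => co j \o f); split => /=.
- exact: cb_mono cb.
- by move=> j lt_jk; apply: (ghom_inj_deg f_inj); rewrite gK; apply: cb_deg cb _ _.
- by move=> j lt_jk; apply: f_inj; rewrite !linearZ /= !gK; apply: cb_x cb _ _.
- by apply: f_inj; rewrite linearZ linear0 /= gK; apply: cb_xlast cb.
- by move=> j p u v; rewrite linearP; apply: cb_lin cb _ _ _ _.
- by move=> i j lt_ik lt_jk; rewrite gK; apply: cb_delta cb _ _ _ _.
- move=> u; apply: f_inj; rewrite linear_sum [LHS](cb_span cb).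
  by apply: eq_bigr => j _; rewrite linearZ /= gK.
- by move=> d u hu; apply: cb_homog cb _ _ _; apply: ghom_deg.
Qed.

Section ChainBasis.
Variables (M : gmod K k) (a : nat -> int) (e : nat -> M) (co : nat -> M -> {poly K}).
Hypothesis cb : @chain_basis M a e co.

Lemma co0 j : co j 0 = 0.
Proof.
apply: (addrI (co j 0)); have := cb_lin cb j 1 0 0.
by rewrite scaler0 !addr0 mul1r => <-.
Qed.

Lemma coD j u v : co j (u + v) = co j u + co j v.
Proof. by have := cb_lin cb j 1 u v; rewrite rmorph1 scale1r mul1r. Qed.

Lemma coZ j p u : co j (polyR k p *: u) = p * co j u.
Proof. by have := cb_lin cb j p u 0; rewrite co0 !addr0. Qed.

Lemma co_sum j (T : Type) (s : seq T) (P : pred T) (u : T -> M) :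
  co j (\sum_(t <- s | P t) u t) = \sum_(t <- s | P t) co j (u t).
Proof. exact: (big_morph (co j) (coD j) (co0 j)). Qed.

Lemma co_x i u : (i < k)%N -> co i (xR K k *: u) =
  if i is i'.+1 then 'X^(absz (a i'.+1 - a i' - 1)%R) * co i' u else 0.
Proof.
move=> lt_ik; rewrite [in LHS](cb_span cb u) scaler_sumr co_sum.
have xe (j : 'I_k) : co i (xR K k *: (polyR k (co j u) *: e j)) =
    if i == j.+1 then 'X^(absz (a j.+1 - a j - 1)%R) * co j u else 0.
  rewrite scalerA mulrC -scalerA; have [lt_jk|le_kj] := ltnP j.+1 k.
    rewrite (cb_x cb lt_jk) !coZ (cb_delta cb lt_ik lt_jk).
    by case: eqP => _; rewrite ?mulr1 ?mulr0 // mulrC.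
  have -> : val j = k.-1 by move: (ltn_ord j) => /=; lia.
  by rewrite (cb_xlast cb) scaler0 co0; case: eqP => // ?; lia.
under eq_bigr do rewrite xe.
case: i lt_ik {xe} => [|i] lt_ik; first by rewrite big1.
rewrite (bigD1 (Ordinal (ltnW lt_ik))) //= eqxx big1 ?addr0 // => j ne_ji.
by case: eqP => // -[ij]; case/eqP: ne_ji; apply: val_inj.
Qed.

(* Setting y = 1 loses nothing on homogeneous elements and removes all powers
   of y from the computations. *)
Definition ev j u : K := (co j u).[1].

Lemma evD j u v : ev j (u + v) = ev j u + ev j v.
Proof. by rewrite /ev coD hornerD. Qed.

Lemma ev0 j : ev j 0 = 0.
Proof. by rewrite /ev co0 horner0. Qed.

Lemma evN j u : ev j (- u) = - ev j u.
Proof. by apply: (addrI (ev j u)); rewrite -evD !subrr ev0. Qed.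

Lemma evZ j p u : ev j (polyR k p *: u) = p.[1] * ev j u.
Proof. by rewrite /ev coZ hornerM. Qed.

Lemma ev_sum j (T : Type) (s : seq T) (P : pred T) (u : T -> M) :
  ev j (\sum_(t <- s | P t) u t) = \sum_(t <- s | P t) ev j (u t).
Proof. exact: (big_morph (ev j) (evD j) (ev0 j)). Qed.

Lemma ev_x i u : (i < k)%N ->
  ev i (xR K k *: u) = if i is i'.+1 then ev i' u else 0.
Proof.
move=> lt_ik; rewrite /ev co_x //; case: i lt_ik => [|i] _; first by rewrite horner0.
by rewrite hornerM hornerXn expr1n mul1r.
Qed.

Lemma ev_xn s i u : (i < k)%N ->
  ev i (xR K k ^+ s *: u) = if (s <= i)%N then ev (i - s) u else 0.
Proof.
elim: s i => [|s IHs] i lt_ik; first by rewrite scale1r subn0.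
rewrite exprS -scalerA ev_x //; case: i lt_ik => [|i] lt_ik //.
by rewrite IHs ?(ltnW lt_ik) // subSS.
Qed.

Lemma ev_delta i j : (i < k)%N -> (j < k)%N -> ev i (e j) = (i == j)%:R.
Proof.
by move=> lt_ik lt_jk; rewrite /ev (cb_delta cb) //; case: eqP;
  rewrite ?horner0 ?hornerC.
Qed.

Lemma co_homog d u j : gdeg d u -> (j < k)%N ->
  co j u = ev j u *: 'X^(absz (a j - d)%R).
Proof.
move=> hu lt_jk.
have coE : co j u = (co j u)`_(absz (a j - d)%R) *: 'X^(absz (a j - d)%R).
  apply/polyP => n; rewrite coefZ coefXn; case: eqP => [->|ne_n]; rewrite ?mulr1 // mulr0.
  by apply/eqP/negP => /negP /(cb_homog cb hu lt_jk); lia.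
by rewrite /ev {2}coE hornerZ hornerXn expr1n mulr1.
Qed.

(** As y has degree -1, multiples of e_j live only in degrees at most a_j. Every support condition
    on D and h comes from this. *)
Lemma ev_homog d u j : gdeg d u -> (j < k)%N -> ev j u != 0 -> d <= a j.
Proof.
move=> hu lt_jk ev_n0; have := cb_homog cb hu lt_jk (n := absz (a j - d)%R).
by rewrite (co_homog hu lt_jk) coefZ coefXn eqxx mulr1 ev_n0 => /(_ isT); lia.
Qed.

Lemma ev_inj d u : gdeg d u -> (forall j, (j < k)%N -> ev j u = 0) -> u = 0.
Proof.
move=> hu ev_u; rewrite (cb_span cb u) big1 // => j _.
by rewrite (co_homog hu) // ev_u // scale0r rmorph0 scale0r.
Qed.

Lemma ev_exists d (c : nat -> K) :
  (forall j, (j < k)%N -> c j != 0 -> d <= a j) ->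
  exists2 u, gdeg d u & forall j, (j < k)%N -> ev j u = c j.
Proof.
move=> c_supp; exists (\sum_(j < k) polyR k (c j)%:P *:
  (polyR k 'X^(absz (a j - d)%R) *: e j)).
  apply: gdeg_sum => j _; have [-> |/(c_supp _ (ltn_ord j)) le_da] := eqVneq (c j) 0.
    by rewrite rmorph0 scale0r; apply: gdeg0.
  by apply: gdeg_polyC; apply: gdeg_polyX (cb_deg cb (ltn_ord j)) _; lia.
move=> j lt_jk; rewrite ev_sum (bigD1 (Ordinal lt_jk)) //= big1 ?addr0 => [|i ne_ij].
  by rewrite !evZ hornerC hornerXn expr1n ev_delta // eqxx mulr1n !mulr1.
rewrite !evZ ev_delta //; case: eqP => [ji|_]; last by rewrite !mulr0.
by case/eqP: ne_ij; apply: val_inj.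
Qed.

End ChainBasis.
End GradedModules.

(** * The chain basis of a standard module *)

Section StandardModules.
Variables (K : fieldType) (k : nat).
Hypothesis k_gt1 : (1 < k)%N.
Let k_gt0 : (0 < k)%N := ltnW k_gt1.
Local Notation R := (hyperR K k).
Variables (i : k.-1.-tuple nat) (ik : int).
Hypothesis i_sorted : sorted leq i.

Let y_exp (j : nat) : nat := std_exp i (k.-1 - j).

Lemma std_exp_mono s t : (s <= t < k)%N -> (std_exp i s <= std_exp i t)%N.
Proof.
case/andP=> le_st lt_tk.
have path_i : sorted leq (0%N :: i) by case: (tval i) i_sorted.
by apply: (sorted_leq_nth leq_trans leqnn 0%N path_i); rewrite ?inE //=
  size_tuple prednK //; apply: leq_ltn_trans lt_tk.
Qed.

Lemma std_exp_anti j l : (j <= l)%N -> (y_exp l <= y_exp j)%N.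
Proof. by move=> le_jl; apply: std_exp_mono; lia. Qed.

(** The degree of x^j y^(y_exp j) after the shift by [ik]. The generators are listed by falling
    powers of x, hence the reversal in [y_exp]. *)
Definition std_degree (j : nat) : int := j%:Z - (y_exp j)%:Z - ik.

Lemma mem_std_index x : x \in std_index i ik <-> exists2 j, (j < k)%N & x = std_degree j.
Proof.
split=> [/imfsetP[s /=]|[j lt_jk ->]].
  rewrite mem_iota add0n => lt_sk ->; exists (k.-1 - s)%N; first by lia.
  by rewrite /std_degree /y_exp subKn; [lia | lia].
apply/imfsetP; exists (k.-1 - j)%N; first by rewrite /= mem_iota; lia.
by rewrite /std_degree /y_exp subKn; [lia | lia].
Qed.

Local Notation Istd := (std_module K i ik).

(** Only generators with x-exponent at most j contribute to the coefficient of x^j, and their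
    y-exponents are at least [y_exp j] because the tuple is sorted. *)
Lemma std_coef_dvd (u : ideal (@std_gen K k i)) j : (j < k)%N ->
  exists q, (ideal_val u : {poly {poly K}})`_j = q * 'X^(y_exp j).
Proof.
move=> lt_jk; case: u => r /= /asboolP[c ->].
have term_dvd (s : 'I_k) : exists q,
    (c s * std_gen K i s : {poly {poly K}})`_j = q * 'X^(y_exp j).
  rewrite /std_gen yRXE mulrA mulrC (coef_polyR_mul k_gt1) (coef_mul_xRX k_gt1) //.
  case: leqP => [le_sj|_]; last by exists 0; rewrite mulr0 mul0r.
  exists ((c s : {poly {poly K}})`_(j - (k.-1 - s)) * 'X^(std_exp i s - y_exp j)).
  by rewrite -mulrA -exprD subnK 1?mulrC // std_exp_mono //; move: (ltn_ord s); lia.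
exists (\sum_s sval (cid (term_dvd s))).
rewrite poly_of_qpoly_sum coef_sum mulr_suml; apply: eq_bigr => s _.
by case: cid.
Qed.

Lemma std_elt_subproof (j : nat) :
  (xR K k ^+ j * yR K k ^+ y_exp j : R^o) \in ideal_pred (@std_gen K k i).
Proof.
have [lt_jk|le_kj] := ltnP j k; last first.
  rewrite -(subnK le_kj) exprD (xRk_eq0 K k_gt1) mulr0 mul0r.
  exact: rpred0.
have lt_sk : (k.-1 - j < k)%N by lia.
apply/asboolP; exists (fun s => (s == Ordinal lt_sk)%:R).
rewrite (bigD1 (Ordinal lt_sk)) //= big1 => [|s /negbTE ->]; last by rewrite mul0r.
by rewrite eqxx mul1r addr0 /std_gen /= subKn //; lia.
Qed.

Definition std_elt (j : nat) : Istd := Ideal (std_elt_subproof j).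

Definition std_coord (j : nat) (u : Istd) : {poly K} :=
  (ideal_val (u : ideal (@std_gen K k i)) : {poly {poly K}})`_j %/ 'X^(y_exp j).

Lemma std_coordE j (u : Istd) : (j < k)%N ->
  std_coord j u * 'X^(y_exp j) =
  (ideal_val (u : ideal (@std_gen K k i)) : {poly {poly K}})`_j.
Proof.
move=> lt_jk; rewrite /std_coord; have [q ->] := std_coef_dvd u lt_jk.
by rewrite mulpK // expf_neq0 ?polyX_eq0.
Qed.

Lemma std_coord_ge j (u : Istd) : (k <= j)%N -> std_coord j u = 0.
Proof. by move=> le_kj; rewrite /std_coord coef_hyperR_ge // div0p. Qed.

Lemma std_module_basis : chain_basis std_degree std_elt std_coord.
Proof.
have Xn0 n : 'X^n != 0 :> {poly K} by rewrite expf_neq0 ?polyX_eq0.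
have valZ p (u : Istd) : ideal_val (polyR k p *: u : Istd) = polyR k p * ideal_val u :> R.
  by [].
split.
- move=> j l /andP[lt_jl lt_lk]; rewrite /std_degree.
  by have := std_exp_anti (ltnW lt_jl); lia.
- move=> j lt_jk; rewrite /std_degree /= /gideal_deg /= subrK.
  have -> : j%:Z - (y_exp j)%:Z = 1 *+ j + (-1) *+ y_exp j by lia.
  by apply: homogRM; apply: homogRX; [apply: homogR_x | apply: homogR_y].
- move=> j lt_jk; apply: val_inj.
  rewrite -[LHS]/(xR K k * (xR K k ^+ j * yR K k ^+ y_exp j)) mulrA -exprS.
  rewrite -[RHS]/(polyR k _ * (xR K k ^+ j.+1 * yR K k ^+ y_exp j.+1)) !yRXE.
  rewrite [RHS]mulrC -mulrA -rmorphM -exprD; congr (_ * polyR k 'X^_).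
  by have := std_exp_anti (leqnSn j); rewrite /std_degree; lia.
- apply: val_inj; rewrite /= -[LHS]/(xR K k * (_ * _)) mulrA -exprS prednK //.
  by rewrite (xRk_eq0 K k_gt1) mul0r.
- move=> j p u v; have [lt_jk|le_kj] := ltnP j k; last first.
    by rewrite !std_coord_ge // mulr0 addr0.
  apply: (mulIf (Xn0 (y_exp j))); rewrite mulrDl -mulrA !std_coordE //.
  rewrite -[ideal_val (_ + _)]/(polyR k p * ideal_val u + ideal_val v).
  by rewrite poly_of_qpolyD coefD coef_polyR_mul.
- move=> j l lt_jk lt_lk; apply: (mulIf (Xn0 (y_exp j))); rewrite std_coordE //=.
  rewrite yRXE mulrC coef_polyR_mul // coef_xRX // lt_jk andbT.
  by case: eqP => [->|_]; rewrite ?mulr1 ?mul1r ?mulr0 ?mul0r.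
- move=> u; apply: val_inj; rewrite /= [LHS](hyperR_expand k_gt1).
  rewrite ideal_val_sum; apply: eq_bigr => j _; rewrite valZ /= -std_coordE //.
  by rewrite rmorphM -mulrA yRXE [polyR _ _ * xR _ _ ^+ _]mulrC.
- move=> d u /= hu j n lt_jk co_n0.
  have := hu j (n + y_exp j)%N.
  rewrite -std_coordE // coefMXn ltnNge leq_addl addnK => /(_ co_n0).
  by rewrite /std_degree; lia.
Qed.

End StandardModules.

Lemma pluecker_chain_basis (K : fieldType) (k : nat) (M : gmod K k) (L : {fset int}) :
  (1 < k)%N -> pluecker_index M L ->
  exists a e co, @chain_basis K k M a e co /\
    forall x, x \in L <-> exists2 j, (j < k)%N & x = a j.
Proof.
move=> k_gt1 [i [ik [i_sorted [f f_bij] ->]]].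
have [e [co cb]] := chain_basis_iso f_bij (std_module_basis K k_gt1 ik i_sorted).
by exists (std_degree i ik), e, co; split=> // x; apply: mem_std_index.
Qed.

(** * Crossing index sets *)

Section Crossing.
Variable k : nat.
Implicit Types a b : nat -> int.

(* The entries (j + c, j) form a diagonal of a k x k matrix.  A degree 0 map
   vanishes where [b (j + c) < a j]; a cocycle can make the diagonal jump only
   where [a m < b (m + c + 1)]. *)
Definition interlaced a b : Prop := exists c j m l,
  [/\ (j <= m < l)%N, (l + c < k)%N, b (j + c)%N < a j,
      a m < b (m + c).+1 & b (l + c)%N < a l].

Definition increasing a := forall i j, (i < j < k)%N -> a i < a j.

Lemma increasing_le a i j : increasing a -> (i <= j < k)%N -> a i <= a j.
Proof.
move=> a_incr /andP[]; rewrite leq_eqVlt => /orP[/eqP-> //|lt_ij] lt_jk.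
by apply/ltW/a_incr; rewrite lt_ij.
Qed.

Lemma increasing_lt a i j : increasing a -> (i < k)%N -> (j < k)%N ->
  a i < a j -> (i < j)%N.
Proof.
move=> a_incr lt_ik lt_jk lt_a; rewrite ltnNge; apply/negP => le_ji.
by have := increasing_le a_incr (introT andP (conj le_ji lt_ik)); rewrite leNgt lt_a.
Qed.

(** The q - p values a_j are distinct, and those shared with b would have to fit into the s - r
    places from r to s - 1. *)
Lemma pigeonhole a b p q r s : increasing a -> (q <= k)%N -> (s - r < q - p)%N ->
  (forall i j, (p <= j < q)%N -> (i < k)%N -> a j = b i -> (r <= i < s)%N) ->
  exists2 j, (p <= j < q)%N & forall i, (i < k)%N -> a j <> b i.
Proof.
move=> a_incr le_qk lt_size ab; apply: contrapT => no_j.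
have a_inj : {in iota p (q - p) &, injective a}.
  move=> i j; rewrite !mem_iota => hi hj aij.
  by have [lt_ij|lt_ji|//] := ltngtP i j; [have := @a_incr i j | have := @a_incr j i];
    rewrite aij ltxx => absurd; suff: false by []; apply: absurd; lia.
suff : (size (map a (iota p (q - p))) <= size (map b (iota r (s - r))))%N.
  by rewrite !size_map !size_iota leqNgt lt_size.
apply: uniq_leq_size; first by rewrite map_inj_in_uniq // iota_uniq.
move=> _ /mapP[j hj ->]; rewrite mem_iota in hj.
have hj' : (p <= j < q)%N by lia.
have [i lt_ik aji] : exists2 i, (i < k)%N & a j = b i.
  apply: contrapT => no_i; apply: no_j; exists j => // i lt_ik aji.
  by apply: no_i; exists i.
by rewrite aji map_f // mem_iota; have := ab _ _ hj' lt_ik aji; lia.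
Qed.

Lemma mem_diff (A B : {fset int}) a b j :
  (forall x, x \in A <-> exists2 j, (j < k)%N & x = a j) ->
  (forall x, x \in B <-> exists2 j, (j < k)%N & x = b j) ->
  (j < k)%N -> (forall i, (i < k)%N -> a j <> b i) -> a j \in (A `\` B)%fset.
Proof.
move=> AE BE lt_jk ajb; rewrite inE; apply/andP; split; last by apply/AE; exists j.
by apply/negP => /BE[i lt_ik]; apply: ajb.
Qed.

End Crossing.

(** Four blocks are each one or more too long to be matched in the other set: b_0..b_(j+c) lies
    below a_j, a_j..a_m strictly between b_(j+c) and b_(m+c+1), b_(m+c+1)..b_(l+c) strictly between
    a_m and a_l, and a_l..a_(k-1) above b_(l+c). An unmatched element of each gives the crossing. *)
Lemma interlaced_crossing k (A B : {fset int}) a b : increasing k a -> increasing k b ->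
  (forall x, x \in A <-> exists2 j, (j < k)%N & x = a j) ->
  (forall x, x \in B <-> exists2 j, (j < k)%N & x = b j) ->
  interlaced k a b -> crossing A B.
Proof.
move=> a_incr b_incr AE BE [c [j [m [l [/andP[le_jm lt_ml] lt_lck bad_j cut_m bad_l]]]]].
have lea := increasing_le a_incr; have leb := increasing_le b_incr.
have lta := increasing_lt a_incr; have ltb := increasing_lt b_incr.
have [i1 hi1 i1P] : exists2 i, (0 <= i < (j + c).+1)%N &
    forall i', (i' < k)%N -> b i <> a i'.
  apply: (@pigeonhole k b a 0 (j + c).+1 0 j) => //; [lia|lia|].
  move=> i' i hi lt_i'k bia; apply: lta => //; first lia.
  by rewrite -bia; apply: le_lt_trans bad_j; apply: leb; lia.
have [j1 hj1 j1P] : exists2 i, (j <= i < m.+1)%N &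
    forall i', (i' < k)%N -> a i <> b i'.
  apply: (@pigeonhole k a b j m.+1 (j + c).+1 (m + c).+1) => //; [lia|lia|].
  move=> i' i hi lt_i'k aib; apply/andP; split; apply: ltb => //; rewrite -?aib; try lia.
    by apply: lt_le_trans bad_j _; apply: lea; lia.
  by apply: le_lt_trans cut_m; apply: lea; lia.
have [i2 hi2 i2P] : exists2 i, ((m + c).+1 <= i < (l + c).+1)%N &
    forall i', (i' < k)%N -> b i <> a i'.
  apply: (@pigeonhole k b a (m + c).+1 (l + c).+1 m.+1 l) => //; [lia|].
  move=> i' i hi lt_i'k bia; apply/andP; split; apply: lta => //; rewrite -?bia; try lia.
    by apply: lt_le_trans cut_m _; apply: leb; lia.
  by apply: le_lt_trans bad_l; apply: leb; lia.
have [j2 hj2 j2P] : exists2 i, (l <= i < k)%N &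
    forall i', (i' < k)%N -> a i <> b i'.
  apply: (@pigeonhole k a b l k (l + c).+1 k) => //; [lia|].
  move=> i' i hi lt_i'k aib; apply/andP; split => //.
  by apply: ltb => //; rewrite -aib; apply: lt_le_trans bad_l _; apply: lea; lia.
exists (a j1), (a j2), (b i1), (b i2); split.
- by apply: (mem_diff AE BE) => //; lia.
- by apply: (mem_diff AE BE) => //; lia.
- by apply: (mem_diff BE AE) => //; lia.
- by apply: (mem_diff BE AE) => //; lia.
right; apply/andP; split; [apply/andP; split|].
- apply: le_lt_trans (_ : b (j + c)%N < _); first by apply: leb; lia.
  by apply: lt_le_trans bad_j _; apply: lea; lia.
- apply: le_lt_trans (_ : a m < _); first by apply: lea; lia.
  by apply: lt_le_trans cut_m _; apply: leb; lia.
- apply: le_lt_trans (_ : b (l + c)%N < _); first by apply: leb; lia.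
  by apply: lt_le_trans bad_l _; apply: lea; lia.
Qed.

(** * From crossings to interlacing, by counting elements up to t *)

Section Counting.
Variable k : nat.
Implicit Types (a b : nat -> int) (t : int).

Definition rank a t : nat := count (fun j => a j <= t) (iota 0 k).

Lemma rank_le a t : (rank a t <= k)%N.
Proof. by rewrite -[k in (_ <= k)%N](size_iota 0); apply: count_size. Qed.

Lemma rank_mono a t t' : t <= t' -> (rank a t <= rank a t')%N.
Proof. by move=> le_t; apply: sub_count => j /le_trans; apply. Qed.

Lemma lt_rank a t j : increasing k a -> (j < k)%N -> (j < rank a t)%N = (a j <= t).
Proof.
move=> a_incr lt_jk; have lea := increasing_le a_incr.
have ltP n : (n <= k)%N ->
    (forall i, (i < n)%N -> a i <= t) -> (forall i, (n <= i < k)%N -> t < a i) ->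
    rank a t = n.
  move=> le_nk lo hi; rewrite /rank -(subnK le_nk) addnC iotaD count_cat add0n.
  rewrite (_ : count _ (iota 0 n) = n); last first.
    rewrite -[RHS](size_iota 0); apply/eqP; rewrite -all_count.
    by apply/allP => i; rewrite mem_iota => hi'; apply: lo; lia.
  rewrite (_ : count _ _ = 0%N) ?addn0 //; apply/eqP; rewrite -leqn0 leqNgt -has_count.
  by apply/hasPn => i; rewrite mem_iota -ltNge => hi'; apply: hi; lia.
have [n [le_nk lo hi]] : exists n, [/\ (n <= k)%N, forall i, (i < n)%N -> a i <= t
    & forall i, (n <= i < k)%N -> t < a i].
  pose P n := (n == k) || (t < a n).
  have exP : exists n, P n by exists k; rewrite /P eqxx.
  case: (ex_minnP exP) => n Pn n_min; exists n; split => [|i lt_in|i hi].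
  - by apply: n_min; rewrite /P eqxx.
  - by rewrite leNgt; apply/negP => lt_ta; have := n_min i;
    rewrite /P lt_ta orbT leqNgt lt_in => /(_ isT).
  - case/orP: Pn => [/eqP nk|lt_tan]; first by move: hi; rewrite nk; lia.
    by apply: lt_le_trans lt_tan _; apply: lea.
rewrite (ltP n) //; have [lt_jn|le_nj] := ltnP j n; first by rewrite lo.
by apply/esym/negbTE; rewrite -ltNge; apply: hi; lia.
Qed.

(** If #{b <= t} exceeds #{a <= t} by more than c, then j = [rank a t] satisfies b_(j+c) <= t < a_j.
    If it does not, m = [rank a t] - 1 satisfies a_m <= t < b_(m+c+1). The three times supply j, m
    and l. *)
Lemma interlaced_rank a b t1 t2 t3 c : increasing k a -> increasing k b ->
  t1 <= t2 -> t2 <= t3 ->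
  (rank a t1 + c < rank b t1)%N -> (rank b t2 <= rank a t2 + c)%N ->
  (rank a t3 + c < rank b t3)%N -> interlaced k a b.
Proof.
move=> a_incr b_incr le12 le23 h1 h2 h3.
have a12 := rank_mono a le12; have a23 := rank_mono a le23.
have b12 := rank_mono b le12; have b23 := rank_mono b le23.
have [b1 b3] := (rank_le b t1, rank_le b t3).
have bad t : (rank a t + c < rank b t)%N -> b (rank a t + c)%N < a (rank a t).
  move=> ht; have bk := rank_le b t.
  have lt_k : (rank a t + c < k)%N by lia.
  have lt_k' : (rank a t < k)%N by lia.
  have := lt_rank t b_incr lt_k; rewrite ht => /esym bt.
  apply: le_lt_trans bt _; rewrite ltNge -lt_rank // ltnn //.
exists c, (rank a t1), (rank a t2).-1, (rank a t3); split; [lia|lia|exact: bad| |exact: bad].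
have lt2 : ((rank a t2).-1 < k)%N by lia.
apply: (@le_lt_trans _ _ t2); first by rewrite -lt_rank //; lia.
have -> : ((rank a t2).-1 + c).+1 = (rank a t2 + c)%N by lia.
by rewrite ltNge -lt_rank // -?leqNgt //; lia.
Qed.

Lemma rank_elt a j : increasing k a -> (j < k)%N ->
  rank a (a j) = j.+1 /\ rank a (a j - 1) = j.
Proof.
move=> a_incr lt_jk; have lea := increasing_le a_incr.
have r1 i : (i < k)%N -> (i < rank a (a j))%N = (i <= j)%N.
  move=> lt_ik; rewrite lt_rank //; have [le_ij|lt_ji] := leqP i j;
    first by rewrite lea ?le_ij.
  by apply/negbTE; rewrite -ltNge a_incr ?lt_ji.
have r2 i : (i < k)%N -> (i < rank a (a j - 1))%N = (i < j)%N.
  move=> lt_ik; rewrite lt_rank //; have [lt_ij|le_ji] := ltnP i j.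
    by have := @a_incr i j; rewrite lt_ij lt_jk => /(_ isT); lia.
  by have : a j <= a i by [rewrite lea ?le_ji]; lia.
have [b1 b2] := (rank_le a (a j), rank_le a (a j - 1)).
have := r1 j lt_jk; have := r2 j lt_jk; have := r1 j.+1; have := r2 j.-1.
by split; lia.
Qed.

Lemma rank_nonelt a t : (forall j, (j < k)%N -> t <> a j) -> rank a (t - 1) = rank a t.
Proof.
move=> nt; apply: eq_in_count => j; rewrite mem_iota => hj.
by have := nt j; lia.
Qed.

(* Look at the walk t |-> #{b <= t} - #{a <= t}: a crossing makes it go up,
   down, up, down, so it is not unimodal above 0 or not unimodal below 0. *)
Lemma crossing_pattern a b i1 j1 i2 j2 : increasing k a -> increasing k b ->
  (i1 < k)%N -> (j1 < k)%N -> (i2 < k)%N -> (j2 < k)%N ->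
  (forall j, (j < k)%N -> b i1 <> a j) -> (forall i, (i < k)%N -> a j1 <> b i) ->
  (forall j, (j < k)%N -> b i2 <> a j) -> (forall i, (i < k)%N -> a j2 <> b i) ->
  b i1 < a j1 -> a j1 < b i2 -> b i2 < a j2 ->
  interlaced k a b \/ interlaced k b a.
Proof.
move=> a_incr b_incr lt_i1 lt_j1 lt_i2 lt_j2 n1 n2 n3 n4 h1 h2 h3.
have [rb1 rb1'] := rank_elt b_incr lt_i1; have [rb2 rb2'] := rank_elt b_incr lt_i2.
have [ra1 ra1'] := rank_elt a_incr lt_j1; have [ra2 ra2'] := rank_elt a_incr lt_j2.
have [q1 q2 q3 q4] :=
  And4 (rank_nonelt n1) (rank_nonelt n2) (rank_nonelt n3) (rank_nonelt n4).
pose g t : int := (rank b t)%:Z - (rank a t)%:Z.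
have up t1 t2 t3 (c : nat) : t1 <= t2 -> t2 <= t3 ->
    c%:Z < g t1 -> g t2 <= c%:Z -> c%:Z < g t3 ->
    interlaced k a b.
  by move=> l12 l23 g1 g2 g3; apply: (@interlaced_rank a b t1 t2 t3 c) => //;
    move: g1 g2 g3; rewrite /g; lia.
have down t1 t2 t3 (c : nat) : t1 <= t2 -> t2 <= t3 ->
    c%:Z < - g t1 -> - g t2 <= c%:Z -> c%:Z < - g t3 -> interlaced k b a.
  by move=> l12 l23 g1 g2 g3; apply: (@interlaced_rank b a t1 t2 t3 c) => //;
    move: g1 g2 g3; rewrite /g; lia.
have [d1 d2 d3 d4] : [/\ g (b i1) = g (b i1 - 1) + 1, g (a j1) = g (a j1 - 1) - 1,
    g (b i2) = g (b i2 - 1) + 1 & g (a j2) = g (a j2 - 1) - 1].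
  by rewrite /g; split; lia.
(* [p], [v], [w] play the parts of a peak, a valley and a peak of the walk. The better end of each
   interval suffices, since only the adjacent steps are compared with it. *)
have [p [lp1 lp2 p1 p2]] : exists p, [/\ b i1 <= p, p <= a j1 - 1,
    g (b i1) <= g p & g (a j1 - 1) <= g p].
  have [le_g|/ltW le_g] := leP (g (b i1)) (g (a j1 - 1)).
    by exists (a j1 - 1); split => //; lia.
  by exists (b i1); split => //; lia.
have [v [lv1 lv2 v1 v2]] : exists v, [/\ a j1 <= v, v <= b i2 - 1,
    g v <= g (a j1) & g v <= g (b i2 - 1)].
  have [le_g|/ltW le_g] := leP (g (a j1)) (g (b i2 - 1)).
    by exists (a j1); split => //; lia.
  by exists (b i2 - 1); split => //; lia.
have [w [lw1 lw2 w1 w2]] : exists w, [/\ b i2 <= w, w <= a j2 - 1,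
    g (b i2) <= g w & g (a j2 - 1) <= g w].
  have [le_g|/ltW le_g] := leP (g (b i2)) (g (a j2 - 1)).
    by exists (a j2 - 1); split => //; lia.
  by exists (b i2); split => //; lia.
(* The offset c is a natural number, so the valley serves as it stands only at height >= 0. Below 0,
   a peak of height <= 0 is an admissible valley of -g; if both peaks are positive, level 0
   separates them from the valley. *)
have [v_ge0|v_lt0] := leP 0 (g v).
  by left; apply: (up p v w (absz (g v))); lia.
have [w_le0|w_gt0] := leP (g w) 0.
  by right; apply: (down v w (a j2) (absz (g w))); lia.
have [p_le0|p_gt0] := leP (g p) 0.
  by right; apply: (down (b i1 - 1) p v (absz (g p))); lia.
by left; apply: (up p v w 0%N); lia.
Qed.

End Counting.

Lemma crossingP k (A B : {fset int}) a b : increasing k a -> increasing k b ->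
  (forall x, x \in A <-> exists2 j, (j < k)%N & x = a j) ->
  (forall x, x \in B <-> exists2 j, (j < k)%N & x = b j) ->
  crossing A B <-> interlaced k a b \/ interlaced k b a.
Proof.
have diffP (C D : {fset int}) (c d : nat -> int) :
    (forall x, x \in C <-> exists2 j, (j < k)%N & x = c j) ->
    (forall x, x \in D <-> exists2 j, (j < k)%N & x = d j) ->
    forall x, x \in (C `\` D)%fset ->
    exists j, [/\ (j < k)%N, x = c j & forall i, (i < k)%N -> x <> d i].
  move=> CE DE x; rewrite inE => /andP[/negP x_D /CE[j lt_jk xE]].
  by exists j; split=> // i lt_ik xd; apply: x_D; apply/DE; exists i.
move=> a_incr b_incr AE BE; split; last first.
  case=> [ab|ba]; first exact: interlaced_crossing AE BE ab.
  have := interlaced_crossing b_incr a_incr BE AE ba.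
  move=> [b1 [b2 [a1 [a2 [hb1 hb2 ha1 ha2 h]]]]]; exists a1, a2, b1, b2; split=> //.
  by case: h => ?; [right|left].
case=> a1 [a2 [b1 [b2 []]]].
move=> /(diffP _ _ _ _ AE BE)[j1 [lt_j1 -> nj1]] /(diffP _ _ _ _ AE BE)[j2 [lt_j2 -> nj2]].
move=> /(diffP _ _ _ _ BE AE)[i1 [lt_i1 -> ni1]] /(diffP _ _ _ _ BE AE)[i2 [lt_i2 -> ni2]].
case=> /andP[/andP[h1 h2] h3].
  by apply/or_comm; apply: (@crossing_pattern k b a j1 i1 j2 i2).
by apply: (@crossing_pattern k a b i1 j1 i2 j2).
Qed.

(* [D] is a cocycle and [h] the degree 0 correction splitting it.  On diagonals
   i >= j, [h] is a partial sum of [D] normalised to vanish at one unreachable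
   entry, hence at all of them; on diagonals i < j both boundary values are 0. *)
Lemma diagonal_solution (K : zmodType) k (a b : nat -> int) (D : nat -> nat -> K) :
  ~ interlaced k a b -> ~ interlaced k b a ->
  (forall i j, (i < k)%N -> (j < k)%N -> D i j != 0 -> a j < b i) ->
  (forall c, (c < k)%N -> \sum_(0 <= t < k - c) D t (t + c)%N = 0) ->
  exists2 h : nat -> nat -> K,
    forall i j, (i < k)%N -> (j < k)%N -> h i j != 0 -> a j <= b i &
    forall i j, (i < k)%N -> (j < k)%N ->
      D i j + (if i is i'.+1 then h i' j else 0) = if (j.+1 < k)%N then h i j.+1 else 0.
Proof.
move=> nab nba D_supp D_sum.
pose bad c j := (j + c < k)%N && (b (j + c)%N < a j).
(* One forced zero per diagonal fixes the free constant of the partial sums; a diagonal without any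
   gets the default 0. *)
have [j0 j0P] : exists j0 : nat -> nat, forall c j, bad c j -> bad c (j0 c).
  have ex_j0 c : exists j0, forall j, bad c j -> bad c j0.
    have [[j0 bad_j0]|no_bad] := pselect (exists j, bad c j); first by exists j0.
    by exists 0%N => j bad_j; case: no_bad; exists j.
  by exists (fun c => sval (cid (ex_j0 c))) => c; case: cid.
pose S c n : K := \sum_(0 <= t < n) D (t + c).+1 t.
pose h i j : K := if (j <= i)%N then S (i - j)%N j - S (i - j)%N (j0 (i - j)%N)
  else \sum_(0 <= t < i.+1) D t (t + (j - i).-1)%N.
(* A non-zero entry of [D] between two forced zeros of a diagonal would interlace a with b. *)
have S_const c j l : (j <= l)%N -> bad c j -> bad c l -> S c j = S c l.
  move=> le_jl /andP[lt_jc bad_j] /andP[lt_lc bad_l].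
  rewrite /S (big_cat_nat (leq0n j) le_jl) /= [X in _ = _ + X]big_nat_cond.
  rewrite [X in _ = _ + X]big1 ?addr0 // => t; rewrite andbT => /andP[le_jt lt_tl].
  apply/eqP/negP => /negP /D_supp cut_t; apply: nab.
  by exists c, j, t, l; split => //; [lia | apply: cut_t; lia].
exists h => [i j lt_ik lt_jk|i j lt_ik lt_jk].
  apply: contraNT; rewrite -ltNge => bad_ij; rewrite /h; case: leqP => [le_ji|lt_ij].
    have bad_j : bad (i - j)%N j by rewrite /bad subnKC // lt_ik.
    have bad_j0 := j0P _ _ bad_j; rewrite subr_eq0; apply/eqP.
    by have [/S_const|/ltnW/S_const] := leqP j (j0 (i - j)%N); [apply|move=> ->].
  (* A non-zero partial sum at a forced zero needs a jump before it and, as the whole diagonal sums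
     to 0, another after it; the three interlace b with a. *)
  apply/negPn/negP => sum_n0; pose c := (j - i).-1.
  have [t [lt_ti cut_t]] : exists t, (t < i.+1)%N /\ D t (t + c)%N != 0.
    apply: contrapT => no_t; case/negP: sum_n0; rewrite big_nat_cond big1 // => t.
    rewrite andbT => /andP[_ lt_ti]; apply/eqP/negP => /negP D_n0.
    by apply: no_t; exists t.
  have [l [hl cut_l]] : exists l, (i < l < k - c)%N /\ D l (l + c)%N != 0.
    apply: contrapT => no_l; case/negP: sum_n0.
    have lt_ck : (c < k)%N by rewrite /c; lia.
    have le_i : (i.+1 <= k - c)%N by rewrite /c; lia.
    have := D_sum c lt_ck; rewrite (big_cat_nat (leq0n i.+1) le_i) /=.
    rewrite [X in _ + X]big_nat_cond [X in _ + X]big1 ?addr0 => [->//|l].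
    rewrite andbT => hl; apply/eqP/negP => /negP D_n0.
    by apply: no_l; exists l.
  apply: nba; exists c, t, i, l; split; [lia|lia| | |].
  - by apply: D_supp cut_t; rewrite /c; lia.
  - by have -> : (i + c).+1 = j by rewrite /c; lia.
  - by apply: D_supp cut_l; rewrite /c; lia.
have [lt_ji|le_ij] := ltnP j i.
  case: i lt_ik lt_ji => // i lt_ik; rewrite ltnS => le_ji.
  have -> : (j.+1 < k)%N by lia.
  rewrite /h le_ji ltnS le_ji subSS.
  have -> : S (i - j)%N j.+1 = S (i - j)%N j + D i.+1 j.
    by rewrite /S big_nat_recr //= subnKC.
  by rewrite [in RHS]addrAC addrC.
pose c := (j - i)%N.
have sumE : D i j + (if i is i'.+1 then h i' j else 0) =
    \sum_(0 <= t < i.+1) D t (t + c)%N.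
  rewrite big_nat_recr //= subnKC // addrC; congr (_ + _).
  rewrite /c; case: i lt_ik le_ij @c => [|i] lt_ik lt_ij c; first by rewrite big_nil.
  by rewrite /h leqNgt lt_ij /= subnS.
rewrite sumE; case: ltnP => [lt_j1k|le_kj1].
  by rewrite /h leqNgt ltnS le_ij /= subSn //.
have -> : i.+1 = (k - c)%N by rewrite /c; lia.
by apply: D_sum; rewrite /c; lia.
Qed.

(** * Splitting extensions *)

Section Splitting.
Variables (K : fieldType) (k : nat).
Local Notation R := (hyperR K k).
Implicit Types M N I J : gmod K k.

Lemma gdeg_co M a e co d (u : M) j N (v : N) : @chain_basis K k M a e co ->
  (j < k)%N -> gdeg d u -> gdeg (a j) v -> gdeg d (polyR k (co j u) *: v).
Proof.
move=> cb lt_jk hu hv; rewrite (co_homog cb hu lt_jk).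
have [->|ev_n0] := eqVneq (ev co j u) 0.
  by rewrite scale0r rmorph0 scale0r; apply: gdeg0.
rewrite -mul_polyC rmorphM -scalerA; apply: gdeg_polyC; apply: gdeg_polyX hv _.
by have := ev_homog cb hu lt_jk ev_n0; lia.
Qed.

Hypothesis k_gt1 : (1 < k)%N.

(** The e_j and their chain relations present M, so any elements of U satisfying the same relations
    are the images of the e_j. *)
Lemma chain_hom M a e co (U : lmodType R) (v : nat -> U) :
  @chain_basis K k M a e co ->
  (forall j, (j < k)%N -> xR K k *: v j =
     if (j.+1 < k)%N then polyR k 'X^(absz (a j.+1 - a j - 1)%R) *: v j.+1 else 0) ->
  exists s : {linear M -> U}, forall u, s u = \sum_(j < k) polyR k (co j u) *: v j.
Proof.
move=> cb vx; pose s u := \sum_(j < k) polyR k (co j u) *: v j.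
have [|g gE] := @linear_exists K k M U s; last by exists g.
apply: poly_linear_linear => // [p u w|u].
  rewrite /s scaler_sumr -big_split; apply: eq_bigr => j _ /=.
  by rewrite (cb_lin cb) rmorphD rmorphM scalerDl scalerA.
pose F j := if (j < k)%N then polyR k (co j (xR K k *: u)) *: v j else 0.
have Fk : F k = 0 by rewrite /F ltnn.
have F0 : F 0%N = 0 by rewrite /F (ltnW k_gt1) (co_x cb) ?(ltnW k_gt1) // rmorph0 scale0r.
have -> : s (xR K k *: u) = \sum_(0 <= j < k) F j.
  by rewrite big_mkord; apply: eq_bigr => j _; rewrite /F ltn_ord.
have -> : xR K k *: s u = \sum_(0 <= j < k) F j.+1.
  rewrite big_mkord scaler_sumr; apply: eq_bigr => j _; rewrite /F.
  rewrite scalerA mulrC -scalerA vx //; case: ltnP => lt_jk; last by rewrite scaler0.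
  by rewrite (co_x cb) // scalerA -rmorphM mulrC.
have : \sum_(0 <= j < k) F j + F k = F 0%N + \sum_(0 <= j < k) F j.+1.
  by rewrite -big_nat_recr // big_nat_recl.
by rewrite Fk F0 addr0 add0r.
Qed.

Lemma extension_section_split I J (E : extension I J) (s : {linear I -> ext_mid E}) :
  (forall d u, gdeg d u -> gdeg d (s u)) -> (forall u, ext_out E (s u) = u) ->
  ext_equiv E (split_extension I J).
Proof.
move=> s_deg sK.
have ex_v x : exists v, ext_in E v = x - s (ext_out E x).
  by have [|v ->] := (@ext_exact _ _ _ _ E (x - s (ext_out E x))).1;
    [rewrite linearB sK subrr | exists v].
pose r x := sval (cid (ex_v x)).
have rE x : ext_in E (r x) = x - s (ext_out E x) by rewrite /r; case: cid.
have in_inj := @ext_inj _ _ _ _ E.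
have [|g gE] := @linear_exists K k (ext_mid E) (gsum J I) (fun x => (r x, ext_out E x)).
  move=> c x z; congr pair; last by rewrite linearP.
  apply: in_inj; rewrite [RHS]linearP /= !rE [ext_out E (_ + _)]linearP /=.
  by rewrite [s (_ + _)]linearP /= scalerBr opprD addrACA.
have g_deg d x : gdeg d x -> gdeg d (g x : gsum J I).
  move=> hx; rewrite gE; split; last exact: ghom_deg.
  apply: (ghom_inj_deg (@ext_inj _ _ _ _ E)); rewrite rE; apply: gdegB => //.
  by apply: s_deg; apply: ghom_deg.
exists (GHom g_deg); split.
- exists (fun y : gsum J I => ext_in E y.1 + s y.2) => [x|[v u]] /=; rewrite gE /=.
    by rewrite rE subrK.
  have out_in : ext_out E (ext_in E v) = 0 by apply/ext_exact; exists v.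
  have outE : ext_out E (ext_in E v + s u) = u by rewrite linearD out_in sK add0r.
  by congr pair => //; apply: in_inj; rewrite rE outE addrK.
- move=> v; rewrite /= gE.
  have out_in : ext_out E (ext_in E v) = 0 by apply/ext_exact; exists v.
  by congr pair => //; apply: in_inj; rewrite rE out_in linear0 subr0.
- by move=> x; rewrite /= gE.
Qed.

Lemma noninterlaced_split I J a e co b f co' :
  @chain_basis K k I a e co -> @chain_basis K k J b f co' ->
  ~ interlaced k a b -> ~ interlaced k b a ->
  forall E : extension I J, ext_equiv E (split_extension I J).
Proof.
move=> cbI cbJ nab nba E; have k_gt0 := ltnW k_gt1.
have in_inj := @ext_inj _ _ _ _ E.
have [et et_deg etE] : exists2 et : nat -> ext_mid E,
    forall j, (j < k)%N -> gdeg (a j) (et j) &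
    forall j, (j < k)%N -> ext_out E (et j) = e j.
  have ex_et j : exists u, (j < k)%N -> gdeg (a j) u /\ ext_out E u = e j.
    have [lt_jk|_] := boolP (j < k)%N; last by exists 0.
    by have [u ? ?] := ghom_lift (@ext_surj _ _ _ _ E) (cb_deg cbI lt_jk); exists u.
  by exists (fun j => sval (cid (ex_et j))) => j lt_jk; case: cid => u /= /(_ lt_jk)[].
pose gap j := absz (a j.+1 - a j - 1)%R.
pose next (v : nat -> ext_mid E) j : ext_mid E :=
  if (j.+1 < k)%N then polyR k 'X^(gap j) *: v j.+1 else 0.
have next_deg v j : (j < k)%N -> (forall j, (j < k)%N -> gdeg (a j) (v j)) ->
    gdeg (a j + 1) (next v j).
  move=> lt_jk v_deg; rewrite /next; case: ifP => [lt_j1k|_]; last exact: gdeg0.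
  apply: gdeg_polyX (v_deg _ lt_j1k) _; rewrite /gap.
  by have := cb_mono cbI (i := j) (j := j.+1); rewrite ltnSn lt_j1k => /(_ isT); lia.
have x_deg N (v : N) d : gdeg d v -> gdeg (d + 1) (xR K k *: v).
  by move=> hv; rewrite addrC; apply: gdegZ hv; apply: homogR_x.
(* [w j] is the defect of the chain relation for the lifts [et]. It lies in J because the relation
   holds in I, and x raises its degree to a_j + 1. *)
have [w w_deg wE] : exists2 w : nat -> J, forall j, (j < k)%N -> gdeg (a j + 1) (w j) &
    forall j, (j < k)%N -> ext_in E (w j) = xR K k *: et j - next et j.
  have ex_w j : exists v, (j < k)%N -> ext_in E v = xR K k *: et j - next et j.
    have [lt_jk|_] := boolP (j < k)%N; last by exists 0.
    have [|v vE] := (@ext_exact _ _ _ _ E (xR K k *: et j - next et j)).1; last by exists v.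
    rewrite linearB linearZ /= etE // /next; case: ltnP => [lt_j1k|le_kj1].
      by rewrite linearZ /= etE // (cb_x cbI lt_j1k) subrr.
    have -> : j = k.-1 by lia.
    by rewrite (cb_xlast cbI) linear0 subrr.
  exists (fun j => sval (cid (ex_w j))) => j lt_jk; case: cid => v /= /(_ lt_jk) // vE.
  apply: (ghom_inj_deg in_inj); rewrite vE; apply: gdegB; last exact: next_deg.
  exact/x_deg/et_deg.
pose D i j := ev co' i (w j).
have D_supp i j : (i < k)%N -> (j < k)%N -> D i j != 0 -> a j < b i.
  by move=> lt_ik lt_jk /(ev_homog cbJ (w_deg j lt_jk) lt_ik); lia.
(* Each term is a defect produced at step t and carried on by the remaining n - 1 - t
   multiplications by x. *)
have x_et n : (n <= k)%N -> exists m v,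
    xR K k ^+ n *: et 0%N =
      (if (n < k)%N then polyR k 'X^m *: et n else 0) + ext_in E v /\
    forall l, (l < k)%N -> ev co' l v =
      \sum_(0 <= t < n) if (n.-1 - t <= l)%N then D (l - (n.-1 - t))%N t else 0.
  elim: n => [|n IHn] lt_nk.
    exists 0%N, 0; rewrite k_gt0 linear0 addr0 expr0 rmorph1 !scale1r; split=> // l _.
    by rewrite big_nil (ev0 cbJ).
  have [m [v [xnE vE]]] := IHn (ltnW lt_nk).
  exists (m + gap n)%N, (polyR k 'X^m *: w n + xR K k *: v); split.
    rewrite exprS -scalerA xnE lt_nk [ext_in E (_ + _)]linearD.
    rewrite ![ext_in E (_ *: _)]linearZ /= wE // scalerDr.
    rewrite [in RHS]scalerBr !scalerA [xR K k * _]mulrC addrA; congr (_ + _).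
    rewrite /next; case: ifP => _; last by rewrite scaler0 add0r subr0.
    by rewrite scalerA -rmorphM -exprD addrC subrK.
  move=> l lt_lk; rewrite (evD cbJ) (evZ cbJ) hornerXn expr1n mul1r (ev_x cbJ) //.
  rewrite big_nat_recr //= subnn subn0 addrC; congr (_ + _).
  case: l lt_lk => [|l] lt_lk.
    rewrite big_nat_cond big1 // => t; rewrite andbT => /andP[_ lt_tn].
    by rewrite leqn0 subn_eq0 leqNgt lt_tn.
  rewrite vE ?(ltnW lt_lk) // !big_nat; apply: eq_bigr => t /andP[_ lt_tn].
  have -> : (n - t = (n.-1 - t).+1)%N by lia.
  by rewrite ltnS subSS.
(* The coefficient of f_(k-1-c) in x^k et_0 = 0 is the sum of [D] over the diagonal j - i = c. *)
have D_sum c : (c < k)%N -> \sum_(0 <= t < k - c) D t (t + c)%N = 0.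
  move=> lt_ck; have [m [v [xkE vE]]] := x_et k (leqnn k).
  move: xkE; rewrite ltnn (xRk_eq0 K k_gt1) scale0r add0r -(linear0 (ext_in E)).
  move=> /in_inj v0; have lt_lk : (k.-1 - c < k)%N by lia.
  have := vE _ lt_lk; rewrite -v0 (ev0 cbJ).
  have le_ck := ltnW lt_ck.
  rewrite (big_cat_nat (leq0n c) le_ck) /= [X in X + _]big_nat_cond.
  rewrite [X in X + _]big1 ?add0r => [|t]; last by case: ifP => //; lia.
  rewrite -[X in \sum_(X <= _ < k) _]add0n big_addn => sum0.
  rewrite [RHS]sum0.
  rewrite !big_nat; apply: eq_bigr => t ht.
  by case: leqP => [_|]; [congr (D _ _); lia | lia].
have [h h_supp hE] := diagonal_solution nab nba D_supp D_sum.
have [hw hw_deg hwE] : exists2 hw : nat -> J, forall j, (j < k)%N -> gdeg (a j) (hw j) &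
    forall j, (j < k)%N -> forall i, (i < k)%N -> ev co' i (hw j) = h i j.
  have ex_hw j : exists v, (j < k)%N ->
      gdeg (a j) v /\ forall i, (i < k)%N -> ev co' i v = h i j.
    have [lt_jk|_] := boolP (j < k)%N; last by exists 0.
    have [i lt_ik|v ? ?] := ev_exists cbJ (d := a j) (c := h^~ j); last by exists v.
    exact: h_supp.
  by exists (fun j => sval (cid (ex_hw j))) => j lt_jk; case: cid => v /= /(_ lt_jk)[].
pose eh j := et j + ext_in E (hw j).
have eh_deg j : (j < k)%N -> gdeg (a j) (eh j).
  by move=> lt_jk; apply: gdegD; [apply: et_deg | apply/ghom_deg/hw_deg].
pose nextJ j : J := if (j.+1 < k)%N then polyR k 'X^(gap j) *: hw j.+1 else 0.
have eh_x j : (j < k)%N -> xR K k *: eh j = next eh j.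
  move=> lt_jk; have next_eh : next eh j = next et j + ext_in E (nextJ j).
    rewrite /next /nextJ; case: ifP => _; last by rewrite linear0 addr0.
    by rewrite scalerDr linearZ.
  have wh0 : w j + xR K k *: hw j - nextJ j = 0.
    apply: (ev_inj cbJ (d := a j + 1)).
      apply: gdegB; first by apply: gdegD; [apply: w_deg | apply/x_deg/hw_deg].
      apply: (ghom_inj_deg in_inj).
      have -> : ext_in E (nextJ j) = next eh j - next et j.
        by rewrite next_eh addrAC subrr add0r.
      by apply: gdegB; apply: next_deg.
    move=> i lt_ik; rewrite (evD cbJ) (evD cbJ) (evN cbJ) (ev_x cbJ) //.
    have -> : ev co' i (nextJ j) = if (j.+1 < k)%N then h i j.+1 else 0.
      rewrite /nextJ; case: ifP => lt_j1k; last by rewrite (ev0 cbJ).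
      by rewrite (evZ cbJ) hornerXn expr1n mul1r hwE.
    rewrite -hE // -/(D i j); apply/eqP; rewrite subr_eq0; apply/eqP; congr (_ + _).
    by case: i lt_ik => // i lt_ik; rewrite hwE // ltnW.
  rewrite /eh next_eh scalerDr -linearZ -[xR K k *: et j](subrK (next et j)) -wE //.
  rewrite addrAC [RHS]addrC; congr (_ + _); rewrite -linearD.
  by congr (ext_in E _); apply/eqP; rewrite -subr_eq0 wh0.
have [s sE] := chain_hom cbI eh_x.
apply: (@extension_section_split I J E s) => [d u hu|u].
  rewrite sE; apply: gdeg_sum => j _.
  by apply: (gdeg_co cbI) => //; apply: eh_deg.
rewrite sE linear_sum [RHS](cb_span cbI u); apply: eq_bigr => j _.
rewrite linearZ /= /eh linearD etE //.
have -> : ext_out E (ext_in E (hw j)) = 0 by apply/ext_exact; exists (hw j).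
by rewrite addr0.
Qed.

End Splitting.

(** * Non-split extensions *)

Section TwistedExtension.
Variables (K : fieldType) (k : nat).
Hypothesis k_gt1 : (1 < k)%N.
Local Notation R := (hyperR K k).
Variables I J : gmod K k.

Lemma extension_finitely_generated (E : extension I J) :
  finitely_generated I -> finitely_generated J -> finitely_generated (ext_mid E).
Proof.
move=> [n [g gE]] [m [h hE]].
pose lift i := sval (cid (@ext_surj _ _ _ _ E (g i))).
have liftE i : ext_out E (lift i) = g i by rewrite /lift; case: cid.
exists (m + n)%N, (fun i => match split i with
  | inl i1 => ext_in E (h i1) | inr i2 => lift i2 end) => u.
have [c cE] := gE (ext_out E u).
have [|v vE] := (@ext_exact _ _ _ _ E (u - \sum_i c i *: lift i)).1.
  rewrite linearB linear_sum [X in X - _]cE -sumrB big1 // => i _.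
  by rewrite linearZ /= liftE subrr.
have [d dE] := hE v.
exists (fun i => match split i with inl i1 => d i1 | inr i2 => c i2 end).
rewrite big_split_ord -[LHS](subrK (\sum_i c i *: lift i)) vE dE linear_sum /=.
congr (_ + _); apply: eq_bigr => i _.
  by rewrite (unsplitK (inl _ i)) linearZ.
by rewrite (unsplitK (inr _ i)).
Qed.

Variables (a : nat -> int) (e : nat -> I) (coI : nat -> I -> {poly K}).
Variables (b : nat -> int) (f : nat -> J) (coJ : nat -> J -> {poly K}).
Hypotheses (cbI : @chain_basis K k I a e coI) (cbJ : @chain_basis K k J b f coJ).
(* The connecting map sends e_j to the sum over i of D i j y^(b i - a j - 1) f_i;
   [D_nil] says that x^k = 0 on the twisted module. *)
Variable D : nat -> nat -> K.
Hypothesis D_supp : forall i j, (i < k)%N -> (j < k)%N -> D i j != 0 -> a j < b i.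
Hypothesis D_nil : forall l j, (l < k)%N -> (j < k)%N ->
  \sum_(0 <= s < k | (j <= s <= l)%N) D (l - s)%N (j + k.-1 - s)%N = 0.

Let k_gt0 : (0 < k)%N := ltnW k_gt1.

Lemma connecting_map_exists : exists delta : I -> J,
  [/\ poly_linear delta, forall d u, gdeg d u -> gdeg (d + 1) (delta u) &
      forall i u, (i < k)%N -> ev coJ i (delta u) = \sum_(j < k) ev coI j u * D i j].
Proof.
have [w [w_deg w_ev]] : exists w : nat -> J,
    (forall j, (j < k)%N -> gdeg (a j + 1) (w j)) /\
    (forall i j, (i < k)%N -> (j < k)%N -> ev coJ i (w j) = D i j).
  have ex_w j : exists v, (j < k)%N ->
      gdeg (a j + 1) v /\ forall i, (i < k)%N -> ev coJ i v = D i j.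
    have [lt_jk|_] := boolP (j < k)%N; last by exists 0.
    have [i lt_ik D_n0|v ? ?] := ev_exists cbJ (d := a j + 1) (c := D^~ j);
      last by exists v.
    by have := D_supp lt_ik lt_jk D_n0; lia.
  exists (fun j => sval (cid (ex_w j))).
  by split=> [j lt_jk|i j lt_ik lt_jk]; case: cid => v /= /(_ lt_jk)[? ev_v] //; apply: ev_v.
exists (fun u => \sum_(j < k) polyR k (coI j u) *: w j); split=> [p u v|d u hu|i u lt_ik].
- rewrite scaler_sumr -big_split; apply: eq_bigr => j _ /=.
  by rewrite (cb_lin cbI) rmorphD rmorphM scalerDl scalerA.
- apply: gdeg_sum => j _.
  (* In the shift J(1) the element [w j] has degree a_j, like the e_j it replaces. *)
  exact: (@gdeg_co K k I a e coI d u j (gshift J 1) (w j) cbI (ltn_ord j) hu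
    (w_deg _ (ltn_ord j))).
- rewrite (ev_sum cbJ); apply: eq_bigr => j _.
  by rewrite (evZ cbJ) w_ev.
Qed.

Let delta := sval (cid connecting_map_exists).

Let delta_lin : poly_linear delta.
Proof. by rewrite /delta; case: cid => ? []. Qed.

Let delta_deg d u : gdeg d u -> gdeg (d + 1) (delta u).
Proof. by rewrite /delta; case: cid => ? [] /= _ + _; apply. Qed.

Let ev_delta_map i u : (i < k)%N ->
  ev coJ i (delta u) = \sum_(j < k) ev coI j u * D i j.
Proof. by rewrite /delta; case: cid => ? [] /= _ _; apply. Qed.

(** The block triangular form of x on an extension that splits over K[y]. *)
Definition mid_x (z : (J * I)%type) : (J * I)%type :=
  (xR K k *: z.1 + delta z.2, xR K k *: z.2).

Lemma mid_x_lin : poly_linear mid_x.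
Proof.
move=> p [w v] [w' v']; rewrite /mid_x /=; congr pair.
  rewrite -[RHS]/(polyR k p *: (_ + delta v) + (_ + delta v')) /=.
  rewrite delta_lin !scalerDr !scalerA [polyR k p * _]mulrC -!addrA; congr (_ + _).
  by rewrite addrCA.
rewrite -[RHS]/(polyR k p *: (_ *: v) + _ *: v') /=.
by rewrite scalerDr !scalerA mulrC.
Qed.

Lemma mid_x_deg d z : gsum_deg d z -> gsum_deg (d + 1) (mid_x z).
Proof.
case=> h1 h2; split => /=; last by rewrite addrC; apply: gdegZ h2; apply: homogR_x.
apply: gdegD; last exact: delta_deg.
by rewrite addrC; apply: gdegZ h1; apply: homogR_x.
Qed.

(** Each path from I to J uses delta once: n - 1 - s steps of x in I, then delta, then s steps of x
    in J, which gives the entry of [D] in row l - s and column j + n - 1 - s. *)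
Lemma mid_x_iter j n : (j < k)%N ->
  [/\ (iter n mid_x (0, e j)).2 = xR K k ^+ n *: e j,
      gsum_deg (a j + n%:Z) (iter n mid_x (0, e j)) &
      forall l, (l < k)%N -> ev coJ l (iter n mid_x (0, e j)).1 =
        \sum_(0 <= s < n | (s <= l)%N && (j + n.-1 - s < k)%N)
           D (l - s)%N (j + n.-1 - s)%N].
Proof.
move=> lt_jk; elim: n => [|n [IH2 IHdeg IHev]].
  split=> [||l lt_lk] /=; first by rewrite scale1r.
    by rewrite addr0; split; [apply: gdeg0 | apply: (cb_deg cbI)].
  by rewrite big_nil (ev0 cbJ).
split=> [||l lt_lk].
- by rewrite /= IH2 scalerA exprS.
- have -> : a j + n.+1%:Z = a j + n%:Z + 1 by lia.
  by rewrite iterS; apply: mid_x_deg.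
rewrite iterS /mid_x /= (evD cbJ) IH2 ev_delta_map // [RHS]big_mkcond [RHS]big_nat_recl //.
rewrite addrC; congr (_ + _).
  rewrite !subn0 /=; case: ifP => lt_jnk; last first.
    rewrite big1 // => t _; rewrite (ev_xn cbI) //; case: leqP => [le_nt|]; rewrite ?mul0r //.
    rewrite (ev_delta cbI) //; last by move: (ltn_ord t); lia.
    by case: eqP => [?|_]; rewrite ?mul0r //; move: (ltn_ord t); lia.
  rewrite (bigD1 (Ordinal lt_jnk)) //= big1 ?addr0 => [|t ne_t].
    by rewrite (ev_xn cbI) // leq_addl addnK (ev_delta cbI) // eqxx mul1r.
  rewrite (ev_xn cbI) //; case: leqP => [le_nt|]; rewrite ?mul0r //.
  rewrite (ev_delta cbI) //; last by move: (ltn_ord t); lia.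
  case: eqP => [tj|_]; rewrite ?mul0r //.
  by case/eqP: ne_t; apply: val_inj => /=; lia.
rewrite (ev_x cbJ) //; case: l lt_lk => [|l] lt_lk; first by rewrite big1.
rewrite IHev ?(ltnW lt_lk) // [LHS]big_mkcond !big_nat; apply: eq_bigr => s hs.
have -> : (j + n.+1.-1 - s.+1 = j + n.-1 - s)%N by lia.
by rewrite ltnS subSS.
Qed.

Lemma mid_x_nil z : iter k mid_x z = 0.
Proof.
have iter_lin := iter_poly_linear k mid_x_lin.
case: z => w v; have -> : (w, v) = (w, 0) + (0, v) :> (J * I)%type.
  by congr pair; rewrite /= ?addr0 ?add0r.
have -> : (0, v) = \sum_(j < k) polyR k (coI j v) *: (0, e j) :> (J * I)%type.
  rewrite [RHS]surjective_pairing (raddf_sum fst) (raddf_sum snd) /=; congr pair.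
    by rewrite big1 // => j _; rewrite scaler0.
  exact: (cb_span cbI).
rewrite (poly_linearD iter_lin) (poly_linear_sum iter_lin) big1 ?addr0 => [|j _].
  have iter_w n : iter n mid_x (w, 0) = (xR K k ^+ n *: w, 0).
    elim: n => [|n IHn]; first by rewrite scale1r.
    by rewrite iterS IHn /mid_x /= scaler0 (poly_linear0 delta_lin) addr0 scalerA exprS.
  by rewrite iter_w (xRk_eq0 K k_gt1) scale0r.
rewrite (poly_linearZ iter_lin) (_ : iter _ _ _ = 0) ?scaler0 //.
have [snd0 [fst_deg _] fst_ev] := mid_x_iter k (ltn_ord j).
rewrite [LHS]surjective_pairing snd0 (xRk_eq0 K k_gt1) scale0r; congr pair.
apply: (ev_inj cbJ fst_deg) => l lt_lk; rewrite fst_ev // -[RHS](D_nil lt_lk (ltn_ord j)).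
by apply: eq_bigl => s; move: (ltn_ord j); lia.
Qed.

Definition mid_action : xaction (J * I)%type := XAction mid_x_lin mid_x_nil.

Definition mid_mod : lmodType R := twisted k_gt1 mid_action.

Lemma mid_polyZ p (z : (J * I)%type) : polyR k p *: (z : mid_mod) = polyR k p *: z.
Proof. exact: twisted_polyZ. Qed.

Lemma mid_xZ (z : (J * I)%type) : xR K k *: (z : mid_mod) = mid_x z.
Proof. exact: twisted_xZ. Qed.

Lemma mid_degZ c d r (z : mid_mod) :
  homogR c r -> @gsum_deg K k J I d z -> @gsum_deg K k J I (c + d) (r *: z).
Proof.
move=> hr hz; have iter_deg n : gsum_deg (d + n%:Z) (iter n mid_x z).
  elim: n => [|n IHn]; first by rewrite addr0.
  have -> : d + n.+1%:Z = d + n%:Z + 1 by lia.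
  by rewrite iterS; apply: mid_x_deg.
apply: (@gdeg_sum K k (gsum J I)) => n _.
have -> : c + d = (c - n%:Z) + (d + n%:Z) by lia.
apply: (@gdegZ K k (gsum J I)) (iter_deg n); apply: homogR_polyR => m rn_n0.
by have := hr n m rn_n0; lia.
Qed.

Definition mid : gmod K k :=
  @GMod K k mid_mod (@gsum_deg K k J I) (@gsum_deg0 K k J I) (@gsum_degB K k J I)
    mid_degZ (@gsum_gen K k J I) (@gsum_indep K k J I).

Lemma mid_dual_basis : poly_dual_basis mid.
Proof.
pose g (t : ('I_k + 'I_k)%type) : mid :=
  match t with inl i => (f i, 0) | inr j => (0, e j) end.
pose co (t : ('I_k + 'I_k)%type) (z : mid) :=
  match t with inl i => coJ i z.1 | inr j => coI j z.2 end.
exists ('I_k + 'I_k)%type, g, co; split=> [[i|j] p u v|[w v]].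
- by rewrite mid_polyZ /= (cb_lin cbJ).
- by rewrite mid_polyZ /= (cb_lin cbI).
rewrite big_sumType /=.
under eq_bigr do rewrite mid_polyZ.
under [X in _ + X]eq_bigr do rewrite mid_polyZ.
rewrite [RHS]surjective_pairing !raddfD !(raddf_sum fst) !(raddf_sum snd) /=.
congr pair.
  rewrite [X in _ = _ + X]big1 ?addr0 => [|j _]; last by rewrite scaler0.
  exact: (cb_span cbJ).
rewrite [X in _ = X + _]big1 ?add0r => [|j _]; last by rewrite scaler0.
exact: (cb_span cbI).
Qed.

Lemma mid_in_exists : exists g : ghom J mid, forall v, g v = (v, 0).
Proof.
have [|g gE] := @linear_exists K k J mid (fun v => (v, 0)).
  apply: poly_linear_linear => // [p u v|v].
    by rewrite mid_polyZ; congr pair; rewrite /= scaler0 addr0.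
  by rewrite mid_xZ /mid_x /= scaler0 (poly_linear0 delta_lin) addr0.
have g_deg d v : gdeg d v -> gdeg d (g v : mid).
  by move=> hv; rewrite gE; split => //; apply: gdeg0.
by exists (GHom g_deg).
Qed.

Lemma mid_out_exists : exists g : ghom mid I, forall z, g z = z.2.
Proof.
have [|g gE] := @linear_exists K k mid I (fun z => z.2).
  apply: poly_linear_linear => // [p u v|v]; first by rewrite mid_polyZ.
  by rewrite mid_xZ.
have g_deg d z : @gdeg K k mid d z -> gdeg d (g z).
  by case=> _; rewrite gE.
by exists (GHom g_deg).
Qed.

(* [t] is the degree 0 part of a retraction of the twisted extension onto [J]. *)
Lemma Ext1_eq0_matrix :
  finitely_generated I -> finitely_generated J -> Ext1_eq0 I J (@MCM K k) ->
  exists t : nat -> nat -> K,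
    (forall i j, (i < k)%N -> (j < k)%N -> t i j != 0 -> a j <= b i) /\
    (forall i j, (i < k)%N -> (j < k)%N ->
      D i j + (if (j.+1 < k)%N then t i j.+1 else 0) =
      if i is i'.+1 then t i' j else 0).
Proof.
move=> fgI fgJ Ext0; have [gin ginE] := mid_in_exists; have [gout goutE] := mid_out_exists.
have gin_inj : injective gin by move=> u v; rewrite !ginE => -[].
have gout_surj u : exists z, gout z = u by exists (0, u); rewrite goutE.
have g_exact z : gout z = 0 <-> exists v, z = gin v.
  rewrite goutE; split=> [|[v ->]]; last by rewrite ginE.
  by case: z => w u /= ->; exists w; rewrite ginE.
pose E := Extension gin_inj gout_surj g_exact.
have mcmE : MCM (ext_mid E).
  split=> [|[|n] // _]; first exact: extension_finitely_generated.
  by apply: (Ext_eq0_regular k_gt1); apply: mid_dual_basis.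
have [F [_ F_in _]] := Ext0 E mcmE.
pose rho z := (F z).1.
have rhoD z z' : rho (z + z') = rho z + rho z' by rewrite /rho linearD.
have rhoZ r z : rho (r *: z) = r *: rho z by rewrite /rho linearZ.
have rho_in v : rho (v, 0) = v by rewrite /rho -[(v, 0)](ginE v) F_in.
have rho_deg d z : @gdeg K k mid d z -> gdeg d (rho z) by case/(ghom_deg F).
exists (fun i j => ev coJ i (rho (0, e j))); split=> [i j lt_ik lt_jk|i j lt_ik lt_jk].
  apply: (ev_homog cbJ) => //; apply: rho_deg; split; first exact: gdeg0.
  exact: (cb_deg cbI).
(* This is R-linearity of the retraction [rho], with delta (e j) entering through the twisted action
   on (0, e j). *)
have x_e : xR K k *: rho (0, e j) = delta (e j) +
    (if (j.+1 < k)%N then polyR k 'X^(absz (a j.+1 - a j - 1)%R) *: rho (0, e j.+1)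
     else 0).
  rewrite -rhoZ mid_xZ /mid_x /= scaler0 add0r.
  have -> : (delta (e j), xR K k *: e j) = (delta (e j), 0) + (0, xR K k *: e j) :> mid.
    by congr pair; rewrite /= ?addr0 ?add0r.
  rewrite rhoD rho_in; congr (_ + _); case: ltnP => [lt_j1k|le_kj1].
    rewrite -rhoZ mid_polyZ (cb_x cbI lt_j1k); congr (rho (_, _)).
    by rewrite /= scaler0.
  have -> : j = k.-1 by lia.
  by rewrite (cb_xlast cbI) -[(0, 0)]/(0 : mid) /rho linear0.
have : ev coJ i (delta (e j)) = D i j.
  rewrite ev_delta_map // (bigD1 (Ordinal lt_jk)) //= big1 ?addr0 => [|l ne_l].
    by rewrite (ev_delta cbI) // eqxx mul1r.
  rewrite (ev_delta cbI) //; case: eqP => [lj|_]; last by rewrite mul0r.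
  by case/eqP: ne_l; apply: val_inj.
move=> <-; have := congr1 (ev coJ i) x_e; rewrite (ev_x cbJ) // (evD cbJ) => ->.
congr (_ + _); case: ifP => _; last by rewrite (ev0 cbJ).
by rewrite (evZ cbJ) hornerXn expr1n mul1r.
Qed.

End TwistedExtension.

Section Nonsplit.
Variables (K : fieldType) (k : nat).
Hypothesis k_gt1 : (1 < k)%N.
Variables (I J : gmod K k) (a : nat -> int) (e : nat -> I) (coI : nat -> I -> {poly K}).
Variables (b : nat -> int) (f : nat -> J) (coJ : nat -> J -> {poly K}).
Hypotheses (cbI : @chain_basis K k I a e coI) (cbJ : @chain_basis K k J b f coJ).
Hypotheses (fgI : finitely_generated I) (fgJ : finitely_generated J).

(** The cocycle is one unit entry at the jump (m+c+1, m). It lies strictly below the main diagonal,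
    where x^k = 0 imposes nothing. A splitting would be 0 on its diagonal from the forced zero at j
    up to m, and -1 from m + 1 up to the forced zero at l. *)
Lemma Ext1_eq0_not_interlaced : Ext1_eq0 I J (@MCM K k) -> ~ interlaced k a b.
Proof.
move=> Ext0 [c [j [m [l [/andP[le_jm lt_ml] lt_lck bad_j cut_m bad_l]]]]].
pose D i n : K := ((i == (m + c).+1) && (n == m))%:R.
have D_supp i n : (i < k)%N -> (n < k)%N -> D i n != 0 -> a n < b i.
  by rewrite /D => _ _; case: andP => [[/eqP -> /eqP ->]|_]; rewrite ?eqxx.
have D_nil i n : (i < k)%N -> (n < k)%N ->
    \sum_(0 <= s < k | (n <= s <= i)%N) D (i - s)%N (n + k.-1 - s)%N = 0.
  move=> lt_ik lt_nk; rewrite big1 // => s hs; rewrite /D.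
  by case: andP => // -[/eqP h1 /eqP h2]; lia.
have [t [t_supp tE]] := Ext1_eq0_matrix k_gt1 cbI cbJ D_supp D_nil fgI fgJ Ext0.
have t_bad n : (n + c < k)%N -> b (n + c)%N < a n -> t (n + c)%N n = 0.
  move=> lt_nck bad_n; apply/eqP/negP => /negP /t_supp le_ab.
  by move: bad_n; rewrite ltNge le_ab //; lia.
have t_step n : (n < l)%N -> D (n + c).+1 n + t (n + c).+1 n.+1 = t (n + c)%N n.
  move=> lt_nl; have := tE (n + c).+1 n.
  by rewrite (_ : (n.+1 < k)%N) //; [apply; lia | lia].
have t_lo d : (j + d <= m)%N -> t (j + d + c)%N (j + d)%N = 0.
  elim: d => [|d IHd] le_m; first by rewrite addn0 t_bad //; lia.
  have := t_step (j + d)%N; rewrite {1}/D; have /negbTE -> : (j + d)%N != m by lia.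
  by rewrite andbF add0r IHd ?addnS ?addSn; [apply; lia | lia].
have t_hi d : (m.+1 + d <= l)%N -> t (m.+1 + d + c)%N (m.+1 + d)%N = -1.
  elim: d => [|d IHd] le_l.
    have := t_step m lt_ml; rewrite /D !eqxx /= addn0 addSn => tm.
    have := t_lo (m - j)%N; rewrite subnKC // => /(_ (leqnn m)) t0.
    by apply/eqP; rewrite -addr_eq0 addrC tm t0.
  have := t_step (m.+1 + d)%N; rewrite {1}/D; have /negbTE -> : (m.+1 + d)%N != m by lia.
  by rewrite andbF add0r IHd ?addnS ?addSn; [apply; lia | lia].
have := t_hi (l - m.+1)%N; rewrite subnKC // => /(_ (leqnn l)).
by rewrite t_bad // => /eqP; rewrite eq_sym oppr_eq0 oner_eq0.
Qed.

(** On or above the main diagonal x^k = 0 requires diagonal sums 0, so the cocycle has entries 1 and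
    -1 at the jumps j and l. A splitting would be -1 between them, in particular at the forced zero
    given by m. *)
Lemma Ext1_eq0_not_interlaced_sym : Ext1_eq0 I J (@MCM K k) -> ~ interlaced k b a.
Proof.
move=> Ext0 [c [j [m [l [/andP[le_jm lt_ml] lt_lck cut_j bad_m cut_l]]]]].
pose D i n : K := ((i == j) && (n == (j + c)%N))%:R - ((i == l) && (n == (l + c)%N))%:R.
have D_supp i n : (i < k)%N -> (n < k)%N -> D i n != 0 -> a n < b i.
  rewrite /D => _ _; case: andP => [[/eqP -> /eqP ->]//|_].
  by case: andP => [[/eqP -> /eqP ->]//|_]; rewrite subrr eqxx.
have D_nil i n : (i < k)%N -> (n < k)%N ->
    \sum_(0 <= s < k | (n <= s <= i)%N) D (i - s)%N (n + k.-1 - s)%N = 0.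
  (* A unit entry at (x, x + c) contributes an amount independent of x, so the two opposite entries
     cancel. *)
  move=> lt_ik lt_nk; have entry_sum x : (x + c < k)%N ->
      \sum_(0 <= s < k | (n <= s <= i)%N)
        ((i - s == x)%N && (n + k.-1 - s == x + c)%N)%:R = (i + c == n + k.-1)%N%:R :> K.
    move=> lt_xck; rewrite big_mkcond (bigD1_seq (i - x)%N) ?iota_uniq //=; last first.
      by rewrite mem_index_iota; lia.
    rewrite big1 ?addr0 => [|s ne_s].
      by case: ifP => hs; [congr (_ %:R); congr nat_of_bool; lia | case: eqP => // ?; lia].
    by case: ifP => // hs; case: andP => // -[/eqP ? _]; case/eqP: ne_s; lia.
  by rewrite sumrB !entry_sum ?subrr //; lia.
have [t [t_supp tE]] := Ext1_eq0_matrix k_gt1 cbI cbJ D_supp D_nil fgI fgJ Ext0.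
(* The entries of [t] along the diagonal, preceded by the boundary value 0 that stands for the
   missing row -1. *)
pose q n := if n is n'.+1 then t n' (n + c)%N else 0.
have q_step n : (n < l)%N -> D n (n + c)%N + q n.+1 = q n.
  move=> lt_nl; have := tE n (n + c)%N.
  by rewrite (_ : ((n + c).+1 < k)%N) //; [apply; lia | lia].
have q_lo n : (n <= j)%N -> q n = 0.
  elim: n => [//|n IHn] lt_nj; have := q_step n; rewrite IHn ?(ltnW lt_nj) // /D.
  have /negbTE -> : n != j by lia.
  have /negbTE -> : n != l by lia.
  by rewrite subrr add0r; apply; lia.
have q_hi d : (j.+1 + d <= l)%N -> q (j.+1 + d)%N = -1.
  elim: d => [|d IHd] le_l.
    have := q_step j; rewrite addn0 (q_lo j) // /D !eqxx.
    have /negbTE -> : j != l by lia.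
    by rewrite subr0 => tj; apply/eqP; rewrite -addr_eq0 addrC tj //; lia.
  have := q_step (j.+1 + d)%N; rewrite IHd; last by lia.
  rewrite /D; have /negbTE -> : (j.+1 + d)%N != j by lia.
  have /negbTE -> : (j.+1 + d)%N != l by lia.
  by rewrite subrr add0r addnS; apply; lia.
have q_bad : q m.+1 = 0.
  apply/eqP/negP => /negP /t_supp le_ab; move: bad_m.
  by rewrite ltNge -addSn le_ab //; lia.
have := q_hi (m - j)%N; rewrite addSn subnKC // q_bad => /(_ lt_ml) /eqP.
by rewrite eq_sym oppr_eq0 oner_eq0.
Qed.

End Nonsplit.

Theorem theoremB (R : realType) (k : nat) (hk : (2 <= k)%N)
    (I J : gmod R[i] k) (hI : MCM I) (hJ : MCM J)
    (fI : generically_free 1 I) (fJ : generically_free 1 J)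
    (LI LJ : {fset int})
    (hLI : pluecker_index I LI) (hLJ : pluecker_index J LJ) :
  Ext1_eq0 I J (@MCM R[i] k) <-> noncrossing LI LJ.
Proof.
have [a [e [coI [cbI LIE]]]] := pluecker_chain_basis hk hLI.
have [b [f [coJ [cbJ LJE]]]] := pluecker_chain_basis hk hLJ.
have crossE := crossingP (cb_mono cbI) (cb_mono cbJ) LIE LJE.
have [[fgI _] [fgJ _]] := (hI, hJ).
split=> [Ext0 /crossE[] | noncross E _].
- exact: (Ext1_eq0_not_interlaced hk cbI cbJ fgI fgJ Ext0).
- exact: (Ext1_eq0_not_interlaced_sym hk cbI cbJ fgI fgJ Ext0).
by apply: (noninterlaced_split hk cbI cbJ) => il; apply: noncross; apply/crossE; [left|right].
Qed.
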